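(* Let $w\in S_n$ be a 1432-avoiding permutation. Then the double and single Schubert polynomials of $w$ satisfy $$\mathfrak{S}_{w}(\mathbf{x},\mathbf{y})=\sum_{T\in \mathrm{SRT}(w,\mathbf{f}_0)}\ \prod_{(i,j)\in D(w)}\ \prod_{t\in T(i,j)}\bigl(x_t-y_{m_{ij}(w)+i-t}\bigr),$$ $$\mathfrak{S}_{w}(\mathbf{x})=\sum_{T\in \mathrm{SRT}(w,\mathbf{f}_0)}\ \prod_{(i,j)\in D(w)}\ \prod_{t\in T(i,j)}x_t.$$
   Context: $S_n$ is the set of permutations $w=w_1w_2\cdots w_n$ of $\{1,\ldots,n\}$. $w$ is 1432-avoiding if there are no indices $i_1<i_2<i_3<i_4$ with $w_{i_1}<w_{i_4}<w_{i_3}<w_{i_2}$. The length $\ell(w)$ is the number of inversions, i.e. pairs $i<j$ with $w_i>w_j$. Rothe diagram: in an $n\times n$ grid, $(i,j)$ denotes the square in row $i$ (from top) and column $j$ (from left). $D(w)$ is the set of squares $(i,j)$ such that $w_i>j$ and $w_h=j$ for some $h>i$. For $(i,j)\in D(w)$ put $m_{ij}(w)=|\{(i,k)\in D(w) : k\le j\}|$. Single-valued Rothe tableaux: $\mathrm{SRT}(w,\mathbf{f})$, for $\mathbf{f}=(f_1,\ldots,f_n)$, is the set of fillings $T$ of $D(w)$ assigning to each square $(i,j)\in D(w)$ a set $T(i,j)$ consisting of exactly one positive integer, such that the entries are weakly decreasing from left to right along each row of $D(w)$, strictly increasing from top to bottom along each column of $D(w)$, and every entry in row $i$ is at most $f_i$.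 $\mathbf{f}_0=(1,2,\ldots,n)$. Schubert polynomials: let $s_i$ be the transposition of $i$ and $i+1$; $ws_i$ is obtained from $w$ by swapping $w_i$ and $w_{i+1}$. Acting only on the $\mathbf{x}$-variables, $\partial_i f=\frac{f-s_if}{x_i-x_{i+1}}$, where $s_if$ interchanges $x_i$ and $x_{i+1}$ in $f$. For $w_0=n\,(n-1)\cdots 1$, $\mathfrak{S}_{w_0}(\mathbf{x},\mathbf{y})=\prod_{i+j\le n}(x_i-y_j)$ (product over $i,j\ge1$); for $w\ne w_0$, $\mathfrak{S}_w(\mathbf{x},\mathbf{y})=\partial_i\mathfrak{S}_{ws_i}(\mathbf{x},\mathbf{y})$ for any $i$ with $\ell(ws_i)=\ell(w)+1$ (independent of the choice). The single Schubert polynomial $\mathfrak{S}_w(\mathbf{x})$ is obtained by setting all $y_i=0$. *)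

(* Defs.v *)
From HB Require Import structures.
From mathcomp Require Import all_boot all_order all_algebra all_fingroup.
From mathcomp Require Import mpoly.

Set Implicit Arguments.
Unset Strict Implicit.
Unset Printing Implicit Defensive.

Import GRing.Theory.
Local Open Scope ring_scope.

(* Positions, values, rows and columns range over 'I_n, so they are shifted   *)
(* down by one: i : 'I_n stands for i.+1.  Tableau entries, flags and the     *)
(* subscripts of the variables x_k, y_k are natural numbers counted from 1.   *)

Section Permutations.
Variable n : nat.
Implicit Types w : 'S_n.

Definition avoids1432 w : bool :=
  ~~ [exists i1 : 'I_n, exists i2 : 'I_n, exists i3 : 'I_n, exists i4 : 'I_n,
       [&& (i1 < i2)%N, (i2 < i3)%N, (i3 < i4)%N,
           (w i1 < w i4)%N, (w i4 < w i3)%N & (w i3 < w i2)%N]].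

Definition plength w : nat :=
  #|[set p : 'I_n * 'I_n | (p.1 < p.2)%N && (w p.2 < w p.1)%N]|.

Definition longest : 'S_n := perm (@rev_ord_inj n).

(* ordS wraps around: this is the transposition s_{i+1} only if i.+1 < n.     *)
Definition simple_transp (i : 'I_n) : 'S_n := tperm i (ordS i).

(* In MathComp (s * w) j = w (s j), so that the product w s_i of the text,    *)
(* which swaps the values in two adjacent positions, has its factors in the   *)
(* opposite order.                                                            *)
Definition swap_at w (i : 'I_n) : 'S_n := (simple_transp i * w)%g.

Definition rothe w : {set 'I_n * 'I_n} :=
  [set c : 'I_n * 'I_n |
    (c.2 < w c.1)%N && [exists h : 'I_n, (c.1 < h)%N && (w h == c.2)]].

Definition rothe_rank w (c : 'I_n * 'I_n) : nat :=
  #|[set d in rothe w | (d.1 == c.1) && (d.2 <= c.2)%N]|.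

(* A filling of D(w) is extended by the empty set outside of D(w), and its    *)
(* entries, being at most f i in row i, lie below (\max_i f i).+1.            *)
Definition filling (f : 'I_n -> nat) : finType :=
  {ffun 'I_n * 'I_n -> {set 'I_(\max_(i < n) f i).+1}}.

Definition SRT w (f : 'I_n -> nat) : {set filling f} :=
  [set T : filling f |
   [&& [forall c : 'I_n * 'I_n, if c \in rothe w then #|T c| == 1%N else T c == set0],
       [forall c : 'I_n * 'I_n, forall t in T c, (0 < t <= f c.1)%N],
       [forall i : 'I_n, forall j : 'I_n, forall k : 'I_n, (j < k)%N ==>
          [forall t in T (i, j), forall u in T (i, k), (u <= t)%N]] &
       [forall j : 'I_n, forall h : 'I_n, forall i : 'I_n, (h < i)%N ==>
          [forall t in T (h, j), forall u in T (i, j), (t < u)%N]]]].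

Definition flag0 (i : 'I_n) : nat := i.+1.

End Permutations.

Section DividedDifference.
Variables (n : nat) (R : comNzRingType).
Implicit Types p q : {mpoly R[n]}.

Lemma divdiff_exists (i j : 'I_n) p :
  exists q, p - msym (tperm i j) p == ('X_i - 'X_j) * q.
Proof.
set s := tperm i j.
pose P p := exists q, p - msym s p = ('X_i - 'X_j) * q.
suff [q Hq] : P p by exists q; apply/eqP.
have P1 : P 1 by exists 0; rewrite msym1 subrr mulr0.
have PM a b : P a -> P b -> P (a * b).
  move=> [qa Ha] [qb Hb]; exists (qa * b + msym s a * qb).
  rewrite mulrDr mulrA -Ha mulrCA -Hb msymM mulrBl mulrBr.
  by rewrite addrA subrK.
have PX k : P 'X_k.
  rewrite /P.
  have -> : msym s 'X_k = 'X_(s k) :> {mpoly R[n]}.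
    by rewrite /msym mmapX mmap1U.
  rewrite /s; case: tpermP => [->|->|_ _].
  - by exists 1; rewrite mulr1.
  - by exists (-1); rewrite mulrN1 opprB.
  - by exists 0; rewrite subrr mulr0.
elim/mpolyind: p => [|c m p _ _ [q Hq]].
  by exists 0; rewrite msym0 subrr mulr0.
have [r Hr] : P 'X_[m].
  rewrite mpolyXE_id; apply: (big_ind P) => // k _.
  by elim: (m k) => [|a IHa]; rewrite ?expr0 ?exprS //; apply: PM.
exists (c *: r + q); rewrite msymD msymZ mulrDr -Hq -scalerAr -Hr scalerBr.
by rewrite opprD addrACA.
Qed.

(* (p - s p) / ('X_i - 'X_j), where s exchanges 'X_i and 'X_j; the quotient   *)
(* is unique when i != j and R is an integral domain.                         *)
Definition divdiff (i j : 'I_n) p : {mpoly R[n]} :=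
  xchoose (divdiff_exists i j p).

Lemma divdiffE (i j : 'I_n) p :
  ('X_i - 'X_j) * divdiff i j p = p - msym (tperm i j) p.
Proof. exact/esym/eqP/(xchooseP (divdiff_exists i j p)). Qed.

(* The k-th of n variables for 1 <= k <= n, and 0 for other k.                *)
Definition mvar (k : nat) : {mpoly R[n]} :=
  if k is k'.+1 then if insub k' is Some i then 'X_i else 0 else 0.

End DividedDifference.

Section Schubert.
Variable n : nat.

(* Polynomials in x with coefficients in Z[y]: divided differences act on the *)
(* x-variables only.                                                          *)
Definition xvar (k : nat) : {mpoly {mpoly int[n]}[n]} := mvar n {mpoly int[n]} k.
Definition yvar (k : nat) : {mpoly {mpoly int[n]}[n]} := (mvar n int k)%:MP.

Definition schubert_longest : {mpoly {mpoly int[n]}[n]} :=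
  \prod_(1 <= i < n.+1) \prod_(1 <= j < n.+1 | (i + j <= n)%N)
    (xvar i - yvar j).

(* k is the number of steps from w up to the longest permutation; an          *)
(* ascent i exists as long as k is positive, so the value 0 is never used.    *)
Fixpoint schubert_rec (k : nat) (w : 'S_n) : {mpoly {mpoly int[n]}[n]} :=
  if k is k'.+1 then
    if [pick i : 'I_n |
          (i.+1 < n)%N && (plength (swap_at w i) == (plength w).+1)] is Some i
    then divdiff i (ordS i) (schubert_rec k' (swap_at w i))
    else 0
  else schubert_longest.

Definition double_schubert (w : 'S_n) : {mpoly {mpoly int[n]}[n]} :=
  schubert_rec (plength (longest n) - plength w) w.

Definition single_schubert (w : 'S_n) : {mpoly int[n]} :=
  map_mpoly (meval (fun=> 0)) (double_schubert w).

End Schubert.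

(* Main.v *)
Require Import Defs.
From mathcomp Require Import all_boot all_order all_algebra all_fingroup.
From mathcomp Require Import mpoly ring zify.

Set Implicit Arguments.
Unset Strict Implicit.
Unset Printing Implicit Defensive.

Import GRing.Theory.
Local Open Scope ring_scope.

(** Let [P_w] be the sum over tableaux on the right-hand side.  The idea is to
    show that [P_w] obeys the recursion which defines Schubert polynomials, at a
    well-chosen ascent.  Below, rows, columns and labels are counted from 1.

    For the longest permutation all columns of the diagram are full, so there is
    one tableau and [P_w] is the product of the [x_i - y_j] with [i + j <= n]
    (lemma [tab_sum_longest]).  For any other [w], let [r] be its first ascent
    and [u = w s_r].  As [w_1 > ... > w_r], the permutation [u] is again
    1432-avoiding ([avoids_swap_first]), so by induction its Schubert polynomial
    is [P_u].  Because divided differences commute and satisfy the braid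
    relations, any ascent may be used in the recursion ([schubert_rec_ascent]),
    and it remains to prove [(x_r - x_(r+1)) P_w = P_u - s_r P_u], where [s_r]
    exchanges [x_r] and [x_(r+1)].

    Put [a = w_r].  The diagram of [u] arises from that of [w] by moving the
    squares of row [r+1] right of column [a] up to row [r], and adding the square
    [(r, a)].  The added square is always filled by [r] and the moved squares
    keep their weights, so [P_u] is [x_r - y_a] times the sum over those tableaux
    of [w] which have entries at most [r] in row [r+1] right of column [a]
    ([tab_sum_swap]).  From now on only the diagram of [w] occurs.

    Fix all entries of a tableau other than [r] and [r+1], and let these two
    vary.  A column which contains two of them has [r] above [r+1].  The number
    [m_ij + i] grows by one from a square to the next square below it in the
    diagram ([content_below]), so these two squares together have the weight
    [(x_r - z) (x_(r+1) - z)] for some [z], which is symmetric.  The other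
    squares labelled [r] or [r+1] are free: in each row they are consecutive
    ([free_interval]), and they can be filled by any number of labels [r+1]
    followed by labels [r], independently for each row ([fibreE]).  Here
    1432-avoidance enters: it makes sure that in each row the squares with a
    partner below are to the right of the free ones ([upper_right]).  As
    [m_ij + i] also grows by one along the row, the sum over the fillings of the
    [p] free squares of a row is the divided difference of
    [(x_r - z_0) ... (x_r - z_p)] for suitable [z_l] among the [y] variables
    ([telescope]), and in particular symmetric.

    In row [r+1] one has [z_0 = y_a], and the restriction on the tableaux which
    come from [u] leaves a single filling, of weight
    [(x_r - z_1) ... (x_r - z_p)].  The factor [x_r - y_a] completes this
    product, and so its divided difference is the sum over all fillings of that
    row in tableaux of [w], while all other factors are symmetric
    ([fibre_difference]).  Adding up all choices of the fixed entries gives the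
    recursion.  The single Schubert polynomial is the case [y = 0]. *)

(* The quotient is obtained by a choice; only its defining equation matters. *)
Opaque divdiff.

(** * Divided differences *)

Section AbstractDifferences.
Variables (K : idomainType) (s t : {rmorphism K -> K}).

(** Divided differences are handled through their defining equations
    [(x_i - x_j) q = p - s p], in a domain with ring morphisms [s] and [t] in
    place of the transpositions of variables. *)
Lemma differences_commute (d e p ps pt pst pts : K) :
  d != 0 -> e != 0 -> s e = e -> t d = d -> (forall u, s (t u) = t (s u)) ->
  d * ps = p - s p -> e * pt = p - t p ->
  d * pst = pt - s pt -> e * pts = ps - t ps -> pst = pts.
Proof.
move=> d0 e0 se td st Eps Ept Epst Epts.
have Es : e * s pt = s p - t (s p) by rewrite -{1}se -rmorphM Ept rmorphB st.
have Et : d * t ps = t p - t (s p).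
  by rewrite -{1}td -rmorphM Eps rmorphB.
apply: (mulfI d0); apply: (mulfI e0).
rewrite Epst mulrBr Ept Es mulrCA Epts mulrBr Eps Et.
ring.
Qed.

(** A triple difference, multiplied by the Vandermonde product of the three
    variables, is the alternating sum of [p] over the six permutations of these
    variables.  The sum stays the same when [s] and [t] exchange their roles, as
    [s t s = t s t], which yields the braid relation. *)
Lemma differences_braid (x y z p q1 q2 q3 : K) :
  x != y -> s x = y -> s y = x -> s z = z -> t x = x -> t y = z ->
  s (s p) = p ->
  (x - y) * q1 = p - s p -> (y - z) * q2 = q1 - t q1 ->
  (x - y) * q3 = q2 - s q2 ->
  (x - y) * (x - z) * (y - z) * q3
  = p - s p - t p + t (s p) + s (t p) - s (t (s p)).
Proof.
move=> xy sx sy sz tx ty ssp E1 E2 E3.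
have Et := congr1 t E1; rewrite rmorphM !rmorphB tx ty in Et.
have E2' : (x - y) * (x - z) * (y - z) * q2
   = (x - z) * (p - s p) - (x - y) * (t p - t (s p)).
  by rewrite -E1 -Et -mulrA E2; ring.
have Es := congr1 s E2'.
rewrite !rmorphM !rmorphB !rmorphM !rmorphB sx sy sz ssp in Es.
have xy0 : x - y != 0 by rewrite subr_eq0.
apply: (mulfI xy0).
transitivity ((x - y) * (x - z) * (y - z) * (q2 - s q2)).
  by rewrite -E3; ring.
rewrite mulrBr E2'.
have -> : (x - y) * (x - z) * (y - z) * s q2
  = - ((y - x) * (y - z) * (x - z) * s q2) by ring.
by rewrite Es; ring.
Qed.
End AbstractDifferences.

Section DividedDifferenceTheory.
Variables (n : nat) (R : idomainType).
Implicit Types p q : {mpoly R[n]}.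

Lemma mpolyXU_inj (i j : 'I_n) : i != j -> 'X_i != 'X_j :> {mpoly R[n]}.
Proof.
move=> neq_ij; apply/eqP=> /(congr1 (fun p : {mpoly R[n]} => p@_U_(i))).
rewrite !mcoeffXU eqxx eq_sym (negPf neq_ij).
by move/eqP; rewrite oner_eq0.
Qed.

Lemma subX_neq0 (i j : 'I_n) : i != j -> 'X_i - 'X_j != 0 :> {mpoly R[n]}.
Proof. by move=> ij; rewrite subr_eq0 mpolyXU_inj. Qed.

Lemma divdiff_unique (i j : 'I_n) p q : i != j ->
  ('X_i - 'X_j) * q = p - msym (tperm i j) p -> divdiff i j p = q.
Proof.
move=> neq_ij eq_q; apply: (mulfI (subX_neq0 neq_ij)).
exact: etrans (divdiffE i j p) (esym eq_q).
Qed.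

Lemma msymXU (s : 'S_n) (i : 'I_n) : msym s 'X_i = 'X_(s i) :> {mpoly R[n]}.
Proof. by rewrite /msym mmapX mmap1U. Qed.

Lemma divdiff_far (i j k l : 'I_n) p :
  uniq [:: i; j; k; l] ->
  divdiff i j (divdiff k l p) = divdiff k l (divdiff i j p).
Proof.
rewrite /= !inE !negb_or => /and4P[/and3P[ij ik il] /andP[jk jl] kl _].
have symB (u : 'S_n) (a b : 'I_n) :
  msym u ('X_a - 'X_b) = 'X_(u a) - 'X_(u b) :> {mpoly R[n]}.
  by rewrite msymB !msymXU.
apply: (@differences_commute _ (msym (tperm i j)) (msym (tperm k l))
          ('X_i - 'X_j) ('X_k - 'X_l) p (divdiff i j p) (divdiff k l p)).
- exact: subX_neq0.
- exact: subX_neq0.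
- by rewrite [LHS]symB !tpermD // eq_sym.
- by rewrite [LHS]symB !tpermD // eq_sym.
- move=> u; rewrite -[LHS]msymMm -[RHS]msymMm; congr (msym _ _).
  have := tpermJ i j (tperm k l); rewrite !tpermD 1?eq_sym // => eqJ.
  by rewrite -[in LHS]eqJ conjgE !mulgA mulgV mul1g.
- exact: divdiffE.
- exact: divdiffE.
- exact: divdiffE.
- exact: divdiffE.
Qed.

Lemma divdiffC (i j : 'I_n) p : i != j -> divdiff i j p = - divdiff j i p.
Proof.
move=> ij; apply: divdiff_unique => //.
by rewrite mulrN -mulNr opprB divdiffE tpermC.
Qed.

Lemma divdiffN (i j : 'I_n) p : i != j -> divdiff i j (- p) = - divdiff i j p.
Proof.
by move=> ij; apply: divdiff_unique => //; rewrite mulrN divdiffE msymN opprD.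
Qed.

Lemma divdiff3E (i j k : 'I_n) p : uniq [:: i; j; k] ->
  ('X_i - 'X_j) * ('X_i - 'X_k) * ('X_j - 'X_k)
     * divdiff i j (divdiff j k (divdiff i j p))
  = p - msym (tperm i j) p - msym (tperm j k) p
    + msym (tperm j k) (msym (tperm i j) p)
    + msym (tperm i j) (msym (tperm j k) p)
    - msym (tperm i j) (msym (tperm j k) (msym (tperm i j) p)).
Proof.
rewrite /= !inE !negb_or => /and3P[/andP[ij ik] jk _].
apply: (@differences_braid _ (msym (tperm i j)) (msym (tperm j k))).
- exact: mpolyXU_inj.
- by rewrite [LHS]msymXU tpermL.
- by rewrite [LHS]msymXU tpermR.
- by rewrite [LHS]msymXU tpermD.
- by rewrite [LHS]msymXU tpermD // eq_sym.
- by rewrite [LHS]msymXU tpermL.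
- by rewrite -[LHS]msymMm tperm2 msym1m.
- exact: divdiffE.
- exact: divdiffE.
- exact: divdiffE.
Qed.

Lemma divdiff_braid (i j k : 'I_n) p : uniq [:: i; j; k] ->
  divdiff i j (divdiff j k (divdiff i j p)) =
  divdiff j k (divdiff i j (divdiff j k p)).
Proof.
move=> u_ijk; have := u_ijk.
rewrite /= !inE !negb_or => /and3P[/andP[ij ik] jk _].
have u_kji : uniq [:: k; j; i].
  by rewrite /= !inE !negb_or !(eq_sym k) (eq_sym j i) ij ik jk.
have neq0 : ('X_i - 'X_j) * ('X_i - 'X_k) * ('X_j - 'X_k) != 0 :> {mpoly R[n]}.
  by rewrite !mulf_neq0 ?subX_neq0.
have swap q : divdiff j k (divdiff i j (divdiff j k q))
            = - divdiff k j (divdiff j i (divdiff k j q)).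
  have ji : j != i by rewrite eq_sym.
  have kj : k != j by rewrite eq_sym.
  rewrite (divdiffC (divdiff i j _) jk) (divdiffC (divdiff j k q) ij).
  by rewrite (divdiffC q jk) (divdiffN _ ji) (divdiffN _ kj) (divdiffN _ kj) opprK.
have sts : msym (tperm i j) (msym (tperm j k) (msym (tperm i j) p))
   = msym (tperm j k) (msym (tperm i j) (msym (tperm j k) p)).
  rewrite -!msymMm; congr (msym _ p).
  have := tpermJ i j (tperm j k); rewrite tpermL tpermD 1?eq_sym // => E1.
  have := tpermJ j k (tperm i j); rewrite tpermR tpermD // => E2.
  by move: E1; rewrite -E2 !conjgE !tpermV !mulgA.
have El := divdiff3E p u_ijk; have Er := divdiff3E p u_kji.
rewrite (tpermC k j) (tpermC j i) sts in El Er.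
have idE (K : comNzRingType) (p' a b c d g e f x y z : K) :
  (z - y) * (z - x) * (y - x) * e = p' - a - b + d + c - g ->
  (x - y) * (x - z) * (y - z) * f = p' - b - a + c + d - g ->
  (x - y) * (x - z) * (y - z) * f = (x - y) * (x - z) * (y - z) * - e.
  move=> E1 E2; rewrite E2.
  have -> : (x - y) * (x - z) * (y - z) * - e
          = (z - y) * (z - x) * (y - x) * e by ring.
  by rewrite E1; ring.
apply: (mulfI neq0); apply: etrans (idE _ _ _ _ _ _ _ _ _ _ _ _ Er El) _.
exact: (congr1 _ (esym (swap p))).
Qed.

End DividedDifferenceTheory.

(** * Ascents, and independence of the recursion from the chosen ascent *)

Section Ascents.
Variable n : nat.
Implicit Types (w : 'S_n) (i j : 'I_n).

Definition ascent w i : bool := (i.+1 < n)%N && (w i < w (ordS i))%N.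

Lemma val_ordS i : (i.+1 < n)%N -> ordS i = i.+1 :> nat.
Proof. by move=> lt_in; rewrite /ordS /= modn_small. Qed.

Lemma swap_atE w i j : swap_at w i j = w (tperm i (ordS i) j).
Proof. by rewrite permM. Qed.

Lemma swap_at_id w i j : j != i -> j != ordS i -> swap_at w i j = w j.
Proof. by move=> ji jSi; rewrite swap_atE tpermD // eq_sym. Qed.

Lemma swap_atL w i : swap_at w i i = w (ordS i).
Proof. by rewrite swap_atE tpermL. Qed.

Lemma swap_atR w i : swap_at w i (ordS i) = w i.
Proof. by rewrite swap_atE tpermR. Qed.

Lemma swap_atK i : involutive ((@swap_at n)^~ i).
Proof. by move=> w; rewrite /swap_at mulgA tperm2 mul1g. Qed.

(** Transporting inversions along the transposition matches those of [w] with
    those of the new permutation, except for the pair of positions that has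
    been swapped. *)
Lemma plength_swap w i : ascent w i -> plength (swap_at w i) = (plength w).+1.
Proof.
case/andP=> lt_in asc_i; have Si := val_ordS lt_in.
pose s := tperm i (ordS i); pose f (p : 'I_n * 'I_n) := (s p.1, s p.2).
have fK : involutive f by case=> a b; rewrite /f /= !tpermK.
rewrite /plength (cardsD1 (i, ordS i)) inE /= swap_atL swap_atR.
rewrite /= modn_small // asc_i ltnSn.
congr _.+1; rewrite -[RHS](card_imset _ (inv_inj fK)) (can2_imset_pre _ fK fK).
apply: eq_card => -[a b]; rewrite !inE /= !swap_atE -/s andbA.
have [ltw|] := ltnP (w (s b)) (w (s a)); last by rewrite !andbF.
rewrite !andbT; move: asc_i Si ltw; rewrite /s xpair_eqE.
move: (ordS i) => i1 asc_i Si.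
have valN (c d : 'I_n) : c <> d -> c != d :> nat.
  by move=> cd; apply: contra_not_neq cd => /val_inj.
by case: (tpermP i i1 a) => [->|->|/valN na /valN na'];
  case: (tpermP i i1 b) => [->|->|/valN nb /valN nb'];
  move: asc_i; rewrite -?val_eqE /= ?Si; lia.
Qed.

Lemma ascent_plength w i :
  (i.+1 < n)%N && (plength (swap_at w i) == (plength w).+1) = ascent w i.
Proof.
apply/idP/idP=> [/andP[lt_in /eqP len]|asc]; last first.
  by have /andP[-> _] := asc; rewrite plength_swap /=.
rewrite /ascent lt_in /=; rewrite ltnNge leq_eqVlt; apply/negP.
case/orP=> [/eqP/val_inj/perm_inj/(congr1 val)/=|lt_w].
  by rewrite modn_small //; lia.
have asc : ascent (swap_at w i) i by rewrite /ascent lt_in swap_atL swap_atR.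
by have := plength_swap asc; rewrite swap_atK len; lia.
Qed.

Lemma longestE i : longest n i = (n - i.+1)%N :> nat.
Proof. by rewrite permE. Qed.

Lemma plength_le_longest w : (plength w <= plength (longest n))%N.
Proof.
apply: subset_leq_card; apply/subsetP=> -[a b]; rewrite !inE /= !longestE.
by case/andP=> lt_ab _; rewrite lt_ab; have := ltn_ord b; lia.
Qed.

Lemma no_ascent_longest w : (forall i, ~~ ascent w i) -> w = longest n.
Proof.
move=> noasc; have step i : (i.+1 < n)%N -> (w (ordS i) < w i)%N.
  move=> lt_in; have := noasc i; rewrite /ascent lt_in /= -leqNgt leq_eqVlt.
  case/orP=> // /eqP/val_inj/perm_inj/(congr1 val)/=.
  by rewrite modn_small //; lia.
have mono d : forall i j, (j = i + d :> nat)%N -> (w j + j <= w i + i)%N.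
  elim: d => [|d IHd] i j eq_j.
    by have -> : j = i by apply: val_inj; rewrite /= eq_j addn0.
  have lt_i : (i.+1 < n)%N by have := ltn_ord j; lia.
  have := IHd (ordS i) j; rewrite val_ordS // => /(_ ltac:(lia)).
  by have := step i lt_i; lia.
(* By [mono], w i + i lies between w (n - 1) + n - 1 and w 0, hence equals n - 1. *)
apply/permP=> i; apply: val_inj; rewrite /= longestE.
have n_gt0 : (0 < n)%N by apply: leq_trans (ltn_ord i).
have lt_last : (n.-1 < n)%N by rewrite prednK.
have := mono (n.-1 - i)%N i (Ordinal lt_last).
have := mono i (Ordinal n_gt0) i erefl.
have := ltn_ord (w (Ordinal n_gt0)); have := ltn_ord i => /=.
by move=> lti ltw low /(_ ltac:(lia)) high; lia.
Qed.

Lemma not_longest_ascent w : w != longest n -> exists i, ascent w i.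
Proof.
move=> neq; apply/existsP; apply: contraR neq => /existsPn no.
exact/eqP/no_ascent_longest.
Qed.

Lemma ascent_lt_longest w i :
  ascent w i -> (plength w < plength (longest n))%N.
Proof. by move/plength_swap <-; apply: plength_le_longest. Qed.

(** The recursion picks an arbitrary ascent, so the value at any other ascent
    has to be compared with it.  Two distant ascents commute, and two adjacent
    ascents satisfy the braid relation; in both cases the two routes meet at a
    permutation which is longer by two or three. *)
Lemma schubert_rec_ascent k w i :
    (plength w + k.+1 = plength (longest n))%N -> ascent w i ->
  schubert_rec k.+1 w = divdiff i (ordS i) (schubert_rec k (swap_at w i)).
Proof.
elim/ltn_ind: k w i => k IHk w i len asc_i.
have neqS i' : (i'.+1 < n)%N -> i' != ordS i'.
  by move=> lti; rewrite -val_eqE /= modn_small //; lia.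
suff indep i' j' : (i' < j')%N -> ascent w i' -> ascent w j' ->
    divdiff i' (ordS i') (schubert_rec k (swap_at w i')) =
    divdiff j' (ordS j') (schubert_rec k (swap_at w j')).
  rewrite /=; case: pickP => [j|/(_ i)]; last by rewrite ascent_plength asc_i.
  rewrite ascent_plength => asc_j.
  have [lt_ij|lt_ji|/val_inj->] := ltngtP i j.
  - exact/esym/(indep i j).
  - exact: (indep j i).
  - reflexivity.
move: i' j' {i asc_i} => i j lt_ij asc_i asc_j.
have Hi := asc_i; have Hj := asc_j; move: Hi Hj.
case/andP=> [ltSi wi] /andP[ltSj wj].
have Si := val_ordS ltSi; have Sj := val_ordS ltSj.
have leni := plength_swap asc_i; have lenj := plength_swap asc_j.
(* Either the four positions are distinct, or j is the successor of i. *)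
have [far|near] := ltnP i.+1 j.
  have nij : j != i by rewrite -val_eqE /=; lia.
  have niSj : ordS j != i by rewrite -val_eqE /= modn_small //; lia.
  have nSij : j != ordS i by rewrite -val_eqE /= modn_small //; lia.
  have nSiSj : ordS j != ordS i by rewrite -val_eqE /= !modn_small //; lia.
  have asc_ij : ascent (swap_at w i) j.
    by rewrite /ascent ltSj !swap_at_id.
  have asc_ji : ascent (swap_at w j) i.
    by rewrite /ascent ltSi !swap_at_id // eq_sym.
  have := ascent_lt_longest asc_ij.
  case: k len IHk => [|k] len IHk.
    by move: len leni; clear; lia.
  move=> _.
  have -> : schubert_rec k.+1 (swap_at w i)
      = divdiff j (ordS j) (schubert_rec k (swap_at (swap_at w i) j)).
    by apply: IHk; [|rewrite leni; move: len; clear; lia|].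
  have -> : schubert_rec k.+1 (swap_at w j)
      = divdiff i (ordS i) (schubert_rec k (swap_at (swap_at w j) i)).
    by apply: IHk; [|rewrite lenj; move: len; clear; lia|].
  have -> : swap_at (swap_at w i) j = swap_at (swap_at w j) i.
    apply/permP=> a; rewrite !swap_atE; congr (w _).
    have eqJ : (tperm i (ordS i) ^ tperm j (ordS j))%g = tperm i (ordS i).
      by rewrite tpermJ !tpermD 1?eq_sym // eq_sym.
    rewrite -!permM -[in RHS]eqJ conjgE.
    by rewrite tpermV -!mulgA tperm2 mulg1.
  apply: divdiff_far; rewrite /= !inE !negb_or (neqS i) // (neqS j) //.
  by rewrite !(eq_sym i) !(eq_sym (ordS i)) nij niSj nSij nSiSj.
have eq_j : j = ordS i by apply: val_inj; rewrite [RHS]Si /=; lia.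
have nij : ordS j != i by rewrite -val_eqE /= modn_small //; lia.
have nSij : ordS j != ordS i by rewrite -val_eqE /= !modn_small //; lia.
have nji : ordS i != i by rewrite -val_eqE /= modn_small //; lia.
have ji : j != i by rewrite eq_j.
have Sjj : ordS j != j by rewrite {2}eq_j.
have [w1 w2] : (w i < w j)%N /\ (w j < w (ordS j))%N by rewrite {1}eq_j wi wj.
have u_i v : swap_at v i i = v j by rewrite swap_atL -eq_j.
have u_j v : swap_at v i j = v i by rewrite [in LHS]eq_j swap_atR.
have u_Sj v : swap_at v i (ordS j) = v (ordS j) by rewrite swap_at_id.
have v_i v : swap_at v j i = v i.
  by rewrite swap_at_id 1?eq_sym.
have asc_ij : ascent (swap_at w i) j by rewrite /ascent ltSj u_j u_Sj (ltn_trans w1).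
have asc_iji : ascent (swap_at (swap_at w i) j) i.
  by rewrite /ascent ltSi -eq_j swap_atL v_i u_i u_Sj.
have asc_ji : ascent (swap_at w j) i.
  by rewrite /ascent ltSi -eq_j swap_atL v_i (ltn_trans w1).
have asc_jij : ascent (swap_at (swap_at w j) i) j.
  by rewrite /ascent ltSj u_j u_Sj v_i swap_atR.
have lenij := plength_swap asc_ij; have lenji := plength_swap asc_ji.
have := ascent_lt_longest asc_iji.
case: k len IHk => [|[|k]] len IHk;
  [by move: len leni lenij; clear; lia|by move: len leni lenij; clear; lia|].
move=> _.
have -> : schubert_rec k.+2 (swap_at w i)
    = divdiff j (ordS j) (schubert_rec k.+1 (swap_at (swap_at w i) j)).
  by apply: IHk; [|rewrite leni; move: len; clear; lia|].
have -> : schubert_rec k.+2 (swap_at w j)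
    = divdiff i (ordS i) (schubert_rec k.+1 (swap_at (swap_at w j) i)).
  by apply: IHk; [|rewrite lenj; move: len; clear; lia|].
have -> : schubert_rec k.+1 (swap_at (swap_at w i) j)
    = divdiff i (ordS i) (schubert_rec k (swap_at (swap_at (swap_at w i) j) i)).
  by apply: IHk; [|rewrite lenij leni; move: len; clear; lia|].
have -> : schubert_rec k.+1 (swap_at (swap_at w j) i)
    = divdiff j (ordS j) (schubert_rec k (swap_at (swap_at (swap_at w j) i) j)).
  by apply: IHk; [|rewrite lenji lenj; move: len; clear; lia|].
have -> : swap_at (swap_at (swap_at w i) j) i
        = swap_at (swap_at (swap_at w j) i) j.
  apply/permP=> a; rewrite !swap_atE; congr (w _).
  rewrite -eq_j.
  have E1 : (tperm i j ^ tperm j (ordS j))%g = tperm i (ordS j).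
    by rewrite tpermJ tpermL tpermD.
  have E2 : (tperm j (ordS j) ^ tperm i j)%g = tperm i (ordS j).
    by rewrite tpermJ tpermR tpermD // eq_sym.
  rewrite -!permM; congr (fun_of_perm _ _).
  by move: E1; rewrite -E2 !conjgE !tpermV !mulgA.
rewrite -eq_j; apply: divdiff_braid.
by rewrite /= !inE !negb_or !(eq_sym i) (eq_sym j (ordS j)) ji nij Sjj.
Qed.

End Ascents.

(** * Rothe diagrams and their tableaux *)

Section RotheDiagram.
Local Open Scope nat_scope.
Variables (n : nat) (w : 'S_n).
Implicit Types e g h i j k : 'I_n.

(** The inverse of [w] names the row of the entry in column [j], over which the
    diagram quantifies. *)
Definition cell i j : bool := (j < w i)%N && (i < (w^-1)%g j)%N.

Lemma mem_rothe i j : ((i, j) \in rothe w) = cell i j.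
Proof.
rewrite inE /=; congr (_ && _); apply/existsP/idP=> [[h /andP[lt_ih /eqP<-]]|lt].
  by rewrite permK.
by exists ((w^-1)%g j); rewrite lt permKV eqxx.
Qed.

Lemma cell_up g h j : cell h j -> (g <= h)%N -> (j < w g)%N -> cell g j.
Proof. by case/andP=> _ lt_h le_gh lt_j; rewrite /cell lt_j; lia. Qed.

Lemma cell_northwest g h j k :
  cell g j -> cell h k -> (g <= h)%N -> (k <= j)%N -> cell g k.
Proof. by case/andP=> lt_jg _ Dhk le_gh le_kj; apply: (cell_up Dhk) => //; lia. Qed.

(** The weight of an entry [t] in the square [(i, j)] is
    [x_t - y_(content i j - t)]. *)
Definition content i j : nat := (rothe_rank w (i, j) + i.+1)%N.

Lemma rothe_rankE i j :
  rothe_rank w (i, j) = #|[set k : 'I_n | cell i k && (k <= j)%N]|.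
Proof.
have inj_i : injective (fun k : 'I_n => (i, k)) by move=> k l [].
rewrite -[RHS](card_imset _ inj_i); apply: eq_card => -[a k].
rewrite in_set /= mem_rothe.
apply/idP/imsetP=> [/and3P[Dk /eqP eq_a le_kj]|[l]].
  by rewrite eq_a in Dk *; exists k; rewrite // inE Dk.
by rewrite in_set => /andP[Dl le_lj] [-> ->]; rewrite Dl eqxx.
Qed.

Lemma card_ord_lt m : (m <= n)%N -> #|[set k : 'I_n | (k < m)%N]| = m.
Proof.
move=> le_mn; rewrite -sum1_card.
by under eq_bigl do rewrite inE; rewrite (big_ord_narrow le_mn) sum1_card card_ord.
Qed.

(** The squares counted by the rank are the columns up to [j] whose entry lies
    below row [i].  Complementing, first among the columns up to [j] and then
    among the rows up to [i], replaces them by rows with a large entry.  In this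
    form the dependence of the content on [i] is visible. *)
Lemma contentE i j : cell i j ->
  content i j = (j.+1 + #|[set e : 'I_n | (e <= i) && (j < w e)]|)%N.
Proof.
case/andP=> lt_jw lt_iw; rewrite /content rothe_rankE.
(* The rows removed from the first i + 1 and the columns removed from the
   first j + 1 correspond under w. *)
pose small := [set e : 'I_n | (e <= i) && (w e <= j)].
have rows : (#|small| + #|[set e : 'I_n | (e <= i) && (j < w e)]| = i.+1)%N.
  rewrite -[RHS](card_ord_lt (ltn_ord i)).
  rewrite -(cardsID [set e : 'I_n | (w e <= j)%N] [set k : 'I_n | (k < i.+1)%N]).
  by congr (_ + _)%N; apply: eq_card => e; rewrite !inE ltnS // andbC ltnNge.
have cols : (#|small| + #|[set k : 'I_n | cell i k && (k <= j)%N]| = j.+1)%N.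
  rewrite -[RHS](card_ord_lt (ltn_ord j)) -(card_imset _ (@perm_inj _ w)).
  rewrite -(cardsID (w @: small) [set k : 'I_n | (k < j.+1)%N]).
  congr (_ + _)%N; apply: eq_card => k; rewrite -(permKV w k) !inE;
    rewrite mem_imset ?inE ?permK; try exact: perm_inj.
    by rewrite ltnS [RHS]andbC -andbA andbb.
  by rewrite /cell permK permKV; lia.
by rewrite -rows -cols; lia.
Qed.

(** Of the rows after [g] and up to [h], only row [h] has its entry right of
    column [j]. *)
Lemma content_below g h j : cell g j -> cell h j -> (g < h)%N ->
    (forall e, (g < e)%N -> (e < h)%N -> ~~ cell e j) ->
  content h j = (content g j).+1.
Proof.
move=> Dg Dh lt_gh empty; rewrite !contentE // -addnS; congr (_ + _)%N.
rewrite (cardsD1 h) inE leqnn; have /andP[-> _] := Dh; rewrite add1n.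
congr _.+1; apply: eq_card => e; rewrite !inE.
have [-> /=|ne_eh] /= := eqVneq e h; first by rewrite leqNgt lt_gh.
have ne_eh' : e != h :> nat by [].
have [lt_je|] := boolP (j < w e)%N; rewrite ?andbF // !andbT.
have [le_eg|lt_ge] := leqP e g; first by lia.
apply/negP=> le_eh; have lt_eh : (e < h)%N by rewrite ltn_neqAle ne_eh'.
by have /negP := empty e lt_ge lt_eh; apply; apply: cell_up Dh _ _.
Qed.

(** If the square [(h', k)] were missing, then [w h'] or [k] would be an entry
    between [j] and [w h], in a row between [h] and the row of the entry [j].
    With [w h] and [j] it forms a 321 pattern, and the small entry [w e] in front
    turns this into a 1432 pattern. *)
Lemma avoids_cell e h h' j k : avoids1432 w ->
    (e < h)%N -> (w e < j)%N -> (h < h')%N -> (j < k)%N ->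
  cell h j -> cell h k -> cell h' j -> cell h' k.
Proof.
move=> av lt_eh lt_ej lt_hh' lt_jk Dhj Dhk Dh'j; apply: contraLR av => notD.
rewrite /avoids1432 negbK.
(* The row x plays the letter 3 of the pattern. *)
suff [x /and4P[lt_hx lt_xp lt_jx lt_xh]] : exists x : 'I_n,
    [&& (h < x)%N, (x < (w^-1)%g j)%N, (j < w x)%N & (w x < w h)%N].
  apply/existsP; exists e; apply/existsP; exists h; apply/existsP; exists x.
  by apply/existsP; exists ((w^-1)%g j); rewrite permKV lt_eh lt_hx lt_xp lt_ej lt_jx.
have /andP[lt_jh' lt_h'p] := Dh'j; have /andP[lt_kh lt_hk] := Dhk.
have [le_kh'|lt_h'k] := ltnP k (w h').
  exists ((w^-1)%g k); move: notD; rewrite /cell le_kh' permKV lt_hk lt_jk lt_kh.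
  by rewrite /= -leqNgt; lia.
by exists h'; rewrite lt_hh' lt_h'p lt_jh'; lia.
Qed.

End RotheDiagram.

Section Tableaux.
Local Open Scope nat_scope.
Variables n N : nat.
Definition tableau (w : 'S_n) (T : {ffun 'I_n -> {ffun 'I_n -> 'I_N.+1}}) :=
  [&& [forall i, forall j, if cell w i j then (0 < T i j <= i.+1)%N
                           else T i j == 0 :> nat],
      [forall i, forall j : 'I_n, forall k : 'I_n,
        [&& (j < k)%N, cell w i j & cell w i k] ==> (T i k <= T i j)%N] &
      [forall j, forall g : 'I_n, forall h : 'I_n,
        [&& (g < h)%N, cell w g j & cell w h j] ==> (T g j < T h j)%N]].

Record tableau_spec (w : 'S_n) (T : 'I_n -> 'I_n -> nat) : Prop := TableauSpec {
  tab_pos : forall i j, cell w i j -> (0 < T i j)%N;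
  tab_flag : forall i j, cell w i j -> (T i j <= i.+1)%N;
  tab_out : forall i j, ~~ cell w i j -> T i j = 0%N;
  tab_row : forall i (j k : 'I_n), (j < k)%N -> cell w i j -> cell w i k ->
              (T i k <= T i j)%N;
  tab_col : forall j (g h : 'I_n), (g < h)%N -> cell w g j -> cell w h j ->
              (T g j < T h j)%N }.

Lemma tableauP w (T : {ffun 'I_n -> {ffun 'I_n -> 'I_N.+1}}) :
  reflect (tableau_spec w (fun i j => T i j)) (tableau w T).
Proof.
apply: (iffP and3P) => [[flagT rowT colT]|[pos flag out row col]]; split.
- by move=> i j Dij; have /forallP/(_ i)/forallP/(_ j) := flagT; rewrite Dij => /andP[].
- by move=> i j Dij; have /forallP/(_ i)/forallP/(_ j) := flagT; rewrite Dij => /andP[].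
- move=> i j /negPf Dij; have /forallP/(_ i)/forallP/(_ j) := flagT.
  by rewrite Dij => /eqP.
- move=> i j k lt_jk Dj Dk.
  have /forallP/(_ i)/forallP/(_ j)/forallP/(_ k) := rowT.
  by rewrite lt_jk Dj Dk.
- move=> j g h lt_jk Dj Dk.
  have /forallP/(_ j)/forallP/(_ g)/forallP/(_ h) := colT.
  by rewrite lt_jk Dj Dk.
- apply/forallP=> i; apply/forallP=> j; case: ifP => [Dij|/negbT Dij].
    by rewrite pos ?flag.
  by rewrite out.
- apply/forallP=> i; apply/forallP=> j; apply/forallP=> k.
  by apply/implyP=> /and3P[? ? ?]; apply: row.
- apply/forallP=> i; apply/forallP=> j; apply/forallP=> k.
  by apply/implyP=> /and3P[? ? ?]; apply: col.
Qed.

(** Every square above [(i, j)] is in the diagram, so strictness of the column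
    and the flag pinch the entry. *)
Lemma tab_full w T (i j : 'I_n) : tableau_spec w T -> cell w i j ->
  (forall e : 'I_n, (e <= i)%N -> (j < w e)%N) -> T i j = i.+1.
Proof.
move=> tT Dij full; apply/eqP; rewrite eqn_leq (tab_flag tT) //=.
have [m] := ubnP i; elim: m i Dij full => // m IHm i Dij full lt_im.
have [i0|i_gt0] := posnP i; first by rewrite i0; exact: (tab_pos tT Dij).
have lt_i : (i.-1 < n)%N by have := ltn_ord i; lia.
pose i' := Ordinal lt_i; have lt_ii : (i' < i)%N by rewrite /=; lia.
have Di'j : cell w i' j by apply: cell_up Dij _ _ => //; [lia|apply: full; lia].
have := tab_col tT lt_ii Di'j Dij; have := IHm i' Di'j.
by move=> /(_ ltac:(move=> e le_ei; apply: full; lia) ltac:(lia)) /=; lia.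
Qed.

End Tableaux.

(** * Telescoping sums over the fillings of one row *)

(** The product of the [p] factors runs over [b - z_l] up to [k] and over
    [a - z_(l+1)] from there on: the sum is the divided difference of
    the product of all [a - z_l]. *)
Lemma telescope (K : comNzRingType) (a b : K) (z : nat -> K) p :
  (a - b) * \sum_(k < p.+1) \prod_(l < p) (if (l < k)%N then b - z l else a - z l.+1)
  = \prod_(l < p.+1) (a - z l) - \prod_(l < p.+1) (b - z l).
Proof.
elim: p => [|p IHp].
  by rewrite !big_ord_recl !big_ord0; ring.
rewrite big_ord_recr /=.
have -> : \prod_(l < p.+1) (if (l < p.+1)%N then b - z l else a - z l.+1)
        = \prod_(l < p.+1) (b - z l).
  by apply: eq_bigr => l _; rewrite ltn_ord.
under eq_bigr => k _.
  rewrite big_ord_recr /= ltnNge -ltnS ltn_ord /=.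
  over.
rewrite -mulr_suml mulrDr mulrA IHp.
rewrite !(@big_ord_recr _ _ _ p.+1) /=.
ring.
Qed.

Section Rank.
Variable n : nat.
Implicit Types (F : {set 'I_n}) (j k : 'I_n).

Definition rank F j : nat := #|[set k in F | (k < j)%N]|.

Lemma rank_lt F j k : j \in F -> (j < k)%N -> (rank F j < rank F k)%N.
Proof.
move=> Fj lt_jk; apply: proper_card; apply/properP; split.
  by apply/subsetP=> l; rewrite !inE => /andP[->] /ltn_trans ->.
by exists j; rewrite !inE ?Fj ?ltnn // lt_jk.
Qed.

Lemma rank_bound F j : j \in F -> (rank F j < #|F|)%N.
Proof.
move=> Fj; apply: proper_card; apply/properP; split.
  by apply/subsetP=> l; rewrite !inE => /andP[].
by exists j; rewrite // !inE ltnn andbF.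
Qed.

Lemma rank_inj F : {in F &, injective (rank F)}.
Proof.
move=> j k Fj Fk eq_r; apply: val_inj.
have [lt_jk|lt_kj|//] := ltngtP j k.
  by have := rank_lt Fj lt_jk; rewrite eq_r ltnn.
by have := rank_lt Fk lt_kj; rewrite eq_r ltnn.
Qed.

(** The rank is a bijection from [F] to the first natural numbers. *)
Lemma big_rank (R : Type) (idx : R) (op : Monoid.com_law idx) F (g : nat -> R) :
  \big[op/idx]_(j in F) g (rank F j) = \big[op/idx]_(l < #|F|) g l.
Proof.
rewrite big_enum_val /=.
pose h (l : 'I_#|F|) := Ordinal (rank_bound (enum_valP l)).
have inj_h : injective h.
  by move=> k l /(congr1 val)/= /rank_inj/enum_val_inj-> //; apply: enum_valP.
by rewrite [RHS](reindex_inj inj_h).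
Qed.

Lemma card_rank_lt F m : (m <= #|F|)%N -> #|[set j in F | (rank F j < m)%N]| = m.
Proof.
move=> le_mF; rewrite -sum1_card.
transitivity (\sum_(j in F) (rank F j < m)%N)%N.
  rewrite [RHS]big_mkcond [LHS]big_mkcond; apply: eq_bigr => j _.
  by rewrite in_set; case: (j \in F); case: (_ < _)%N.
rewrite (big_rank _ F (fun l => (l < m)%N : nat)) /=.
rewrite [LHS](eq_bigr (fun l : 'I_#|F| => if (l < m)%N then 1%N else 0%N)) //.
  by rewrite -big_mkcond (big_ord_narrow le_mF) sum1_card card_ord.
Qed.

End Rank.

Section RowSum.
Variables (n N q : nat) (ltqN : (q < N)%N).
Implicit Types (F : {set 'I_n}) (rho : {ffun 'I_n -> 'I_N.+1}).

(** The rows of the tableaux in a fibre have this form, where [F] consists of the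
    free squares and [rho0] is the row of any tableau of the fibre. *)
Definition two_valued F rho0 rho : bool :=
  [&& [forall j, (j \notin F) ==> (rho j == rho0 j)],
      [forall j in F, (rho j == q :> nat) || (rho j == q.+1 :> nat)] &
      [forall j in F, forall k in F, (j < k)%N ==> (rho k <= rho j)%N]].

Definition step_row F rho0 (m : nat) : {ffun 'I_n -> 'I_N.+1} :=
  [ffun j => if j \in F then if (rank F j < m)%N then inord q.+1 else inord q
             else rho0 j].

Lemma step_rowE F rho0 m j : j \in F ->
  step_row F rho0 m j = (if (rank F j < m)%N then q.+1 else q) :> nat.
Proof.
by move=> Fj; rewrite ffunE Fj; case: ifP => _; rewrite inordK // ltnS // ltnW.
Qed.

Lemma step_row_two_valued F rho0 m : two_valued F rho0 (step_row F rho0 m).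
Proof.
apply/and3P; split.
- by apply/forallP=> j; apply/implyP=> /negPf nFj; rewrite ffunE nFj.
- by apply/forall_inP=> j Fj; rewrite step_rowE //; case: ifP; rewrite eqxx ?orbT.
- apply/forall_inP=> j Fj; apply/forall_inP=> k Fk; apply/implyP=> lt_jk.
  rewrite !step_rowE //; have := rank_lt Fj lt_jk.
  by case: ifP => //; case: ifP => //; lia.
Qed.

Lemma card_step_row F rho0 m : (m <= #|F|)%N ->
  #|[set j in F | step_row F rho0 m j == q.+1 :> nat]| = m.
Proof.
move=> le_mF; rewrite -[RHS](card_rank_lt le_mF); apply: eq_card => j.
rewrite !inE; have [Fj|//] := boolP (j \in F); rewrite step_rowE //.
by case: ifP => _; rewrite ?eqxx //= ltn_eqF.
Qed.

Lemma two_valued_step F rho0 rho : two_valued F rho0 rho ->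
  step_row F rho0 #|[set j in F | rho j == q.+1 :> nat]| = rho.
Proof.
case/and3P=> /forallP off /forall_inP val2 /forall_inP decr.
apply/ffunP=> j; have [Fj|nFj] := boolP (j \in F); last first.
  by rewrite ffunE (negPf nFj); apply/esym/eqP; have := off j; rewrite nFj.
apply: val_inj; rewrite /= step_rowE //.
have mono k l : k \in F -> l \in F -> (k < l)%N -> (rho l <= rho k)%N.
  by move=> Fk Fl lt_kl; have /forall_inP/(_ l Fl)/implyP := decr k Fk; apply.
case/orP: (val2 j Fj) => /eqP rho_j; rewrite rho_j; last first.
  rewrite (_ : (_ < _)%N) //; apply: proper_card; apply/properP; split.
    apply/subsetP=> k; rewrite !inE => /andP[Fk lt_kj]; rewrite Fk /=.
    have := mono k j Fk Fj lt_kj; rewrite rho_j.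
    by case/orP: (val2 k Fk) => /eqP ->; rewrite ?ltnn.
  by exists j; rewrite !inE ?ltnn ?andbF // Fj rho_j /=.
rewrite (_ : (_ < _)%N = false) //; apply: negbTE; rewrite -leqNgt.
apply: subset_leq_card; apply/subsetP=> k; rewrite !inE => /andP[Fk /eqP rho_k].
rewrite Fk /= ltnNge leq_eqVlt; apply/negP=> /orP[/eqP/val_inj eq_jk|lt_jk].
  by move: rho_j; rewrite eq_jk rho_k => /eqP; rewrite gtn_eqF.
by have := mono j k Fj Fk lt_jk; rewrite rho_j rho_k ltnn.
Qed.

(** A weakly decreasing filling of [F] by two values is determined by the number
    of its larger values, which come first. *)
Lemma sum_two_valued (K : comNzRingType) F rho0 (G : 'I_n -> nat -> K) :
  \sum_(rho | two_valued F rho0 rho) \prod_(j in F) G j (rho j) =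
  \sum_(k < #|F|.+1) \prod_(j in F) G j (if (rank F j < k)%N then q.+1 else q).
Proof.
pose h (k : 'I_#|F|.+1) := step_row F rho0 k.
pose h' rho : 'I_#|F|.+1 := inord #|[set j in F | rho j == q.+1 :> nat]|.
have card_le rho : (#|[set j in F | rho j == q.+1 :> nat]| < #|F|.+1)%N.
  by rewrite ltnS; apply: subset_leq_card; apply/subsetP=> j; rewrite inE => /andP[].
rewrite (reindex_onto h h') => [|rho two]; last first.
  by rewrite /h inordK // two_valued_step.
apply: eq_big => [k|k _].
  rewrite step_row_two_valued /=; apply/eqP; apply: val_inj.
  by rewrite /= inordK // card_step_row // -ltnS.
by apply: eq_bigr => j Fj; rewrite step_rowE.
Qed.

End RowSum.

(** * Tableaux near the first ascent *)

Section RankInInterval.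
Local Open Scope nat_scope.
Variables (n : nat) (D : pred 'I_n) (F : {set 'I_n}).
Hypothesis subFD : forall j, j \in F -> D j.

Lemma rank_split j : j \in F ->
  #|[set k | D k && (k <= j)]| =
  #|[set k | D k && (k < j) & k \notin F]| + rank F j + 1.
Proof.
move=> Fj; rewrite (cardsD1 j) inE subFD // leqnn addnC; congr (_ + _).
rewrite -(cardsID F) addnC; congr (_ + _); apply: eq_card => k; rewrite !inE.
  rewrite andbC (@ltn_neqAle k) -val_eqE.
  by case: (D k); case: (k \in F); case: (_ == _); case: (_ <= _).
have [Fk|] := boolP (k \in F); last by rewrite andbF.
by rewrite andbT subFD //= [RHS]ltn_neqAle.
Qed.

(** A set [F] of consecutive members of [D] is preceded by the same number of
    members of [D], whichever element of [F] is looked at. *)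
Lemma rank_interval :
    (forall j k l : 'I_n, j \in F -> k \in F -> j < l -> l < k -> D l -> l \in F) ->
  exists c, forall j, j \in F -> #|[set k | D k && (k <= j)]| = c + rank F j + 1.
Proof.
move=> itvF; have [->|[j0 Fj0]] := set_0Vmem F.
  by exists 0 => j; rewrite inE.
exists #|[set k | D k && (k < j0) & k \notin F]| => j Fj.
rewrite rank_split //; congr (_ + _ + _); apply: eq_card => k; rewrite !inE.
case Dk: (D k) => //=; have [|nFk] := boolP (k \in F); rewrite ?andbF ?andbT //.
have ne l : l \in F -> k != l :> nat.
  by move=> Fl; apply: contraNneq nFk => /val_inj->.
apply/idP/idP=> lt_k; rewrite ltnNge leq_eqVlt eq_sym negb_or ne //=;
  apply/negP=> lt_jk; case/negP: nFk.
  exact: itvF Fj0 Fj lt_jk lt_k Dk.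
exact: itvF Fj Fj0 lt_jk lt_k Dk.
Qed.

End RankInInterval.

Section Strip.
Local Open Scope nat_scope.
Variables (n : nat) (w : 'S_n) (r : 'I_n) (T : 'I_n -> 'I_n -> nat).
Implicit Types e g h i j k l : 'I_n.
Hypothesis tabT : tableau_spec w T.
Local Notation q := r.+1.

(** The squares filled by one of the two labels [q] and [q+1].  A column has at
    most two of them.  If it has two, their entries are forced: [q+1] in the
    lower one and [q] in the upper one.  The others are the free ones. *)
Definition strip i j := cell w i j && ((T i j == q) || (T i j == q.+1)).
Definition lower i j := strip i j && [exists g : 'I_n, (g < i) && strip g j].
Definition upper i j := strip i j && [exists h : 'I_n, (i < h) && strip h j].
Definition free_cols i : {set 'I_n} :=
  [set j | [&& strip i j, ~~ lower i j & ~~ upper i j]].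

Lemma tab_col_inj j g h :
  cell w g j -> cell w h j -> T g j = T h j -> g = h.
Proof.
move=> Cg Ch eqT; apply: val_inj; have [lt|lt|//] := ltngtP g h.
  by have := tab_col tabT lt Cg Ch; rewrite eqT ltnn.
by have := tab_col tabT lt Ch Cg; rewrite eqT ltnn.
Qed.

Lemma strip_cell i j : strip i j -> cell w i j. Proof. by case/andP. Qed.

Lemma strip_ge i j : strip i j -> q <= T i j.
Proof. by case/andP=> _ /orP[/eqP->|/eqP->]. Qed.

Lemma strip_le i j : strip i j -> T i j <= q.+1.
Proof. by case/andP=> _ /orP[/eqP->|/eqP->]. Qed.

Lemma stripP i j : cell w i j -> q <= T i j -> T i j <= q.+1 -> strip i j.
Proof. by move=> Dij; rewrite /strip Dij /=; lia. Qed.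

Lemma strip_pair g h j : g < h -> strip g j -> strip h j ->
  (T g j = q) /\ (T h j = q.+1).
Proof.
move=> lt_gh Sg Sh; have := tab_col tabT lt_gh (strip_cell Sg) (strip_cell Sh).
by have := strip_ge Sg; have := strip_le Sh; lia.
Qed.

Lemma lower_val i j : lower i j -> T i j = q.+1.
Proof.
by case/andP=> Si /existsP[g /andP[lt_gi Sg]]; have [] := strip_pair lt_gi Sg Si.
Qed.

Lemma upper_val i j : upper i j -> T i j = q.
Proof. by case/andP=> Si /existsP[h /andP[lt_ih Sh]]; case: (strip_pair lt_ih Si Sh). Qed.

Lemma strip_row_ge i j : strip i j -> r <= i.
Proof.
by move=> S; have := strip_ge S; have := tab_flag tabT (strip_cell S); lia.
Qed.

(** The diagram contains the north-west corner of any two of its squares, so the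
    upper partner of [(i, j)] has a neighbour in column [k], and this neighbour
    has to be filled by [q]. *)
Lemma lower_left i j k : lower i j -> strip i k -> k < j -> lower i k.
Proof.
move=> Lij Sik lt_kj; have Tij := lower_val Lij.
have /andP[Sij /existsP[g /andP[lt_gi Sgj]]] := Lij.
have [Tgj _] := strip_pair lt_gi Sgj Sij.
have Dgk : cell w g k.
  by apply: cell_northwest (strip_cell Sgj) (strip_cell Sik) _ _; apply: ltnW.
rewrite /lower Sik; apply/existsP; exists g; rewrite lt_gi.
have := tab_row tabT lt_kj Dgk (strip_cell Sgj).
have := tab_col tabT lt_gi Dgk (strip_cell Sik).
by have := strip_le Sik => le1 le2 le3; apply: stripP => //; lia.
Qed.

Lemma in_free i j : (j \in free_cols i) = [&& strip i j, ~~ lower i j & ~~ upper i j].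
Proof. by rewrite inE. Qed.

Lemma free_strip i j : j \in free_cols i -> strip i j.
Proof. by rewrite in_free => /and3P[]. Qed.

End Strip.

Section FirstAscent.
Local Open Scope nat_scope.
Variables (n : nat) (w : 'S_n) (r r1 : 'I_n).
Implicit Types e g h i j k l : 'I_n.
Hypotheses (r1E : r1 = r.+1 :> nat)
           (desc : forall i j : 'I_n, i < j -> j <= r -> w j < w i)
           (asc_r : w r < w r1) (av : avoids1432 w).

Lemma initial_le e : e <= r -> w r <= w e.
Proof.
move=> le_er; have [->//|ne] := eqVneq e r; apply/ltnW/desc => //.
by rewrite ltn_neqAle le_er andbT.
Qed.

(** Up to the first ascent the entries decrease, so these rows of the diagram
    are left-justified. *)
Lemma cell_initial i j : i <= r -> cell w i j = (j < w i).
Proof.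
move=> le_ir; rewrite /cell; case: ltnP => //= lt_j; rewrite ltnNge; apply/negP=> le_pi.
have := permKV w j; have [eq_p|lt_p] := eqVneq ((w^-1)%g j) i.
  by rewrite eq_p => eq_j; move: lt_j; rewrite eq_j ltnn.
move=> eq_j; have := @desc ((w^-1)%g j) i; rewrite eq_j.
rewrite ltn_neqAle lt_p le_pi => /(_ isT le_ir) lt_ij.
by have := ltn_trans lt_j lt_ij; rewrite ltnn.
Qed.

Lemma full_initial i j e : i <= r -> j < w i -> e <= i -> j < w e.
Proof.
move=> le_ir lt_j; rewrite leq_eqVlt => /orP[/eqP/val_inj->//|lt_ei].
exact: ltn_trans lt_j (desc lt_ei le_ir).
Qed.

Lemma full_below j e : j < w r -> e <= r1 -> j < w e.
Proof.
move=> lt_j; rewrite leq_eqVlt r1E ltnS => /orP[/eqP|le_er].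
  by rewrite -r1E => /val_inj->; apply: ltn_trans asc_r.
exact: leq_trans lt_j (initial_le le_er).
Qed.

(** All entries down to row [r1] are at least [w r], so the columns left of
    [w r] are full down to there. *)
Lemma cell_below j : j < w r -> cell w r1 j.
Proof.
move=> lt_j; rewrite /cell (full_below lt_j) //= ltnNge; apply/negP=> le_p.
by have := full_below lt_j le_p; rewrite permKV ltnn.
Qed.

Lemma cell_below_neq j : cell w r1 j -> j != w r :> nat.
Proof.
case/andP=> _; rewrite r1E; apply: contraTneq => /val_inj->.
by rewrite permK -leqNgt leqnSn.
Qed.

Section WithTableau.
Variable T : 'I_n -> 'I_n -> nat.
Hypothesis tabT : tableau_spec w T.
Local Notation q := r.+1.
Local Notation strip := (strip w r T).
Local Notation lower := (lower w r T).
Local Notation upper := (upper w r T).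
Local Notation free_cols := (free_cols w r T).

Lemma tab_corner_left j : j < w r -> T r1 j = q.+1.
Proof.
move=> lt_j; rewrite -r1E; apply: (tab_full tabT (cell_below lt_j)) => e.
exact: full_below.
Qed.

Lemma tab_corner_row j : j < w r -> T r j = q.
Proof.
move=> lt_j; apply: (tab_full tabT); first by rewrite cell_initial.
by move=> e; apply: full_initial.
Qed.

Lemma strip_corner j : j < w r -> strip r j.
Proof. by move=> lt_j; rewrite stripP ?cell_initial ?tab_corner_row. Qed.

Lemma strip_corner_below j : j < w r -> strip r1 j.
Proof. by move=> lt_j; rewrite stripP ?cell_below ?tab_corner_left. Qed.

Lemma strip_r_upper j : strip r j -> upper r j.
Proof.
move=> S; have lt_j : j < w r by rewrite -(@cell_initial r) // (strip_cell S).
rewrite /upper S; apply/existsP; exists r1.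
by rewrite strip_corner_below // r1E ltnSn.
Qed.

(** The step that uses 1432-avoidance.  If some entry above row [i] is smaller
    than [j], then [avoids_cell] provides the square below [(i, k)] that is
    needed as a partner.  Otherwise the column of [j] is full down to row [i],
    so its entry [q] puts [i] in row [r], where all squares with label [q] lie
    above a label [q+1]. *)
Lemma upper_right i j k : upper i j -> strip i k -> j < k -> upper i k.
Proof.
move=> Uij Sik lt_jk; have Tij := upper_val tabT Uij.
have /andP[Sij /existsP[h /andP[lt_ih Shj]]] := Uij.
have [_ Thj] := strip_pair tabT lt_ih Sij Shj.
have [eq_ir|ne_ir] := eqVneq i r.
  by rewrite eq_ir in Sik *; apply: strip_r_upper.
have [/existsP[e /andP[lt_ei lt_ej]]|full] :=
    boolP [exists e : 'I_n, (e < i) && (w e < j)].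
  have Dhk : cell w h k.
    exact: avoids_cell av lt_ei lt_ej lt_ih lt_jk (strip_cell Sij)
      (strip_cell Sik) (strip_cell Shj).
  have Tik := tab_row tabT lt_jk (strip_cell Sij) (strip_cell Sik).
  have Thk := tab_row tabT lt_jk (strip_cell Shj) Dhk.
  have Thi := tab_col tabT lt_ih (strip_cell Sik) Dhk.
  have := strip_ge Sik => ge_ik.
  rewrite /upper Sik; apply/existsP; exists h; rewrite lt_ih.
  by apply: stripP => //; lia.
have /andP[lt_jw lt_ip] := strip_cell Sij.
have fullT : T i j = i.+1.
  apply: (tab_full tabT (strip_cell Sij)) => e.
  rewrite leq_eqVlt => /orP[/eqP/val_inj->//|lt_ei].
  move/existsPn: full => /(_ e); rewrite lt_ei /= -leqNgt leq_eqVlt.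
  case/orP=> // /eqP/val_inj eq_j.
  by move: lt_ip; rewrite eq_j permK ltnNge ltnW.
by case/eqP: ne_ir; apply: val_inj; move: fullT; rewrite Tij => -[].
Qed.

Lemma free_row_gt i j : j \in free_cols i -> r < i.
Proof.
move=> Fj; have := strip_row_ge tabT (free_strip Fj).
rewrite leq_eqVlt => /orP[/eqP/val_inj eq_ri|//].
move: Fj; rewrite in_free -eq_ri => /and3P[Sj _].
by rewrite (strip_r_upper Sj).
Qed.

(** By [lower_left] and [upper_right] the forced squares stand at the two ends
    of the strip of a row, which leaves an interval to the free ones. *)
Lemma free_interval i (j k l : 'I_n) :
  j \in free_cols i -> k \in free_cols i -> j < l -> l < k -> cell w i l ->
  l \in free_cols i.
Proof.
move=> Fj Fk lt_jl lt_lk Dl; have Sj := free_strip Fj; have Sk := free_strip Fk.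
have Tl := tab_row tabT lt_jl (strip_cell Sj) Dl.
have Tk := tab_row tabT lt_lk Dl (strip_cell Sk).
have Sl : strip i l.
  by apply: stripP => //; have := strip_ge Sk; have := strip_le Sj; lia.
rewrite in_free Sl /=; move: Fj Fk; rewrite !in_free => /and3P[_ nLj _].
case/and3P=> _ _ nUk; apply/andP; split.
  by apply: contra nLj => Ll; exact: (lower_left tabT Ll Sj lt_jl).
by apply: contra nUk => Ul; apply: upper_right Ul Sk lt_lk.
Qed.

Lemma lower_corner j : j < w r -> lower r1 j.
Proof.
move=> lt_j; rewrite /lower strip_corner_below //=; apply/existsP; exists r.
by rewrite strip_corner // r1E ltnSn.
Qed.

Lemma lower_corner_lt j : lower r1 j -> j < w r.
Proof.
case/andP=> S /existsP[g /andP[lt_g Sg]]; have := strip_row_ge tabT Sg => le_rg.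
have eq_g : g = r.
  by apply/val_inj/eqP; rewrite eqn_leq le_rg andbT -ltnS -r1E.
by move: (strip_cell Sg); rewrite eq_g cell_initial.
Qed.

Lemma free_below_gt j : j \in free_cols r1 -> w r < j.
Proof.
move=> Fj; have := cell_below_neq (strip_cell (free_strip Fj)).
move: Fj; rewrite in_free => /and3P[_ nL _].
by have [/lower_corner|//|] := ltngtP j (w r); rewrite ?(negPf nL).
Qed.

Lemma free_below_left j k :
  k \in free_cols r1 -> cell w r1 j -> w r < j -> j < k -> j \in free_cols r1.
Proof.
move=> Fk Dj gt_j lt_jk; have Sk := free_strip Fk.
have := tab_row tabT lt_jk Dj (strip_cell Sk) => Tjk.
have := tab_flag tabT Dj; rewrite r1E => le_T.
have Sj : strip r1 j by apply: stripP => //; apply: leq_trans (strip_ge Sk) _.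
rewrite in_free Sj /=; apply/andP; split.
  by apply/negP=> /lower_corner_lt; rewrite ltnNge ltnW.
move: Fk; rewrite in_free => /and3P[_ _]; apply: contra => Uj.
exact: upper_right Uj Sk lt_jk.
Qed.

(** The content grows by one from each square of a row to the next one. *)
Lemma free_content i : exists c,
  forall j, j \in free_cols i -> content w i j = c + rank (free_cols i) j + 1.
Proof.
have [c cE] := rank_interval (fun j Fj => strip_cell (@free_strip _ w r T i j Fj))
                 (@free_interval i).
exists (c + i.+1) => j Fj; rewrite /content rothe_rankE cE //; lia.
Qed.

(** In row [r1] the squares before the free ones are those left of column
    [w r], so the starting value of the content is explicit. *)
Lemma free_below_content j : j \in free_cols r1 ->
  content w r1 j = (w r).+1 + q + rank (free_cols r1) j + 1.
Proof.
move=> Fj; have lt_wj := free_below_gt Fj.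
rewrite /content rothe_rankE.
rewrite (rank_split (fun k Fk => strip_cell (@free_strip _ w r T r1 k Fk)) Fj).
rewrite (_ : #|_| = w r); first by rewrite r1E; lia.
rewrite -[RHS](card_ord_lt (ltnW (ltn_ord (w r)))).
apply: eq_card => k; rewrite [RHS]in_set [LHS]in_set.
apply/idP/idP=> [/andP[/andP[Dk lt_kj] nFk]|lt_k].
  rewrite ltnNge leq_eqVlt eq_sym negb_or cell_below_neq //=.
  by apply/negP=> lt_wk; rewrite (free_below_left Fj Dk lt_wk lt_kj) in nFk.
rewrite cell_below // (ltn_trans lt_k lt_wj).
by rewrite in_free (lower_corner lt_k) /= andbF.
Qed.

End WithTableau.
End FirstAscent.

(** * Tableaux that differ only in the entries r and r+1 *)

Section Fibre.
Variables (n N : nat) (w : 'S_n) (r r1 : 'I_n).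
Implicit Types i j : 'I_n.
Implicit Types (T : {ffun 'I_n -> {ffun 'I_n -> 'I_N.+1}}).
Hypotheses (r1E : r1 = r.+1 :> nat)
           (desc : forall i j : 'I_n, (i < j)%N -> (j <= r)%N -> (w j < w i)%N)
           (asc_r : (w r < w r1)%N) (av : avoids1432 w).
Hypothesis N_big : forall i, (i < N)%N.
Local Notation q := r.+1.
Local Notation ent T := (fun i j => nat_of_ord (T i j)).

Lemma ltqN : (q < N)%N. Proof. by rewrite -r1E. Qed.

(** Two tableaux lie in the same fibre of [erase] when they have the same entries
    up to exchanging [q] and [q+1]. *)
Definition erase T : {ffun 'I_n -> {ffun 'I_n -> 'I_N.+1}} :=
  [ffun i => [ffun j => if T i j == q.+1 :> nat then inord q else T i j]].

Lemma eraseP T T0 :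
  reflect (forall i j, T i j = T0 i j \/
             (q <= T i j <= q.+1)%N && (q <= T0 i j <= q.+1)%N)
          (erase T == erase T0).
Proof.
apply: (iffP eqP) => [eqT i j|near].
  have /(congr1 val) :=
    congr1 (fun U : {ffun 'I_n -> {ffun 'I_n -> 'I_N.+1}} => U i j) eqT.
  rewrite /= !ffunE; have lt := ltqN.
  case: eqP => eT; case: eqP => eT0 /=; rewrite ?inordK; try lia.
  - by move=> /val_inj; left.
apply/ffunP=> i; apply/ffunP=> j; apply: val_inj; rewrite !ffunE.
have [->//|] := near i j; have lt := ltqN.
by case: eqP => eT; case: eqP => eT0 /=; rewrite ?inordK; lia.
Qed.

Section WithTableau.
Variable T0 : {ffun 'I_n -> {ffun 'I_n -> 'I_N.+1}}.
Hypothesis tab0 : tableau_spec w (ent T0).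
Local Notation F := (free_cols w r (ent T0)).
Local Notation strip0 := (strip w r (ent T0)).
Local Notation lower0 := (lower w r (ent T0)).
Local Notation upper0 := (upper w r (ent T0)).

Lemma notin_free i j : j \notin F i -> strip0 i j -> lower0 i j \/ upper0 i j.
Proof. by rewrite in_free => nF Sj; move: nF; rewrite Sj /= negb_and !negbK => /orP. Qed.

(** The strip is the same for all tableaux of a fibre, hence so are the forced
    entries. *)
Lemma fibre_two_valued T : tableau w T -> erase T == erase T0 ->
  forall i, two_valued q (F i) (T0 i) (T i).
Proof.
move=> /tableauP tabT /eraseP near i.
have stripE g h : strip w r (ent T) g h = strip0 g h.
  rewrite /strip; case: (cell w g h) => //=.
  have [->//|] := near g h; clear; lia.
have lowerE g h : lower w r (ent T) g h = lower0 g h.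
  rewrite /lower stripE; congr (_ && _); apply: eq_existsb => e.
  by rewrite stripE.
have upperE g h : upper w r (ent T) g h = upper0 g h.
  rewrite /upper stripE; congr (_ && _); apply: eq_existsb => e.
  by rewrite stripE.
apply/and3P; split.
- apply/forallP=> j; apply/implyP=> nFj; apply/eqP; apply: val_inj.
  have [Sj|nSj] := boolP (strip0 i j).
    have [L|U] := notin_free nFj Sj.
      by have := L; rewrite -lowerE => /(lower_val tabT)/= ->; rewrite (lower_val tab0 L).
    by have := U; rewrite -upperE => /(upper_val tabT)/= ->; rewrite (upper_val tab0 U).
  have [->//|near_ij] := near i j; case/negP: nSj.
  have Dij : cell w i j.
    apply/negPn/negP=> nD; have /= := tab_out tabT nD.
    by move: near_ij; clear; lia.
  by rewrite /strip Dij /=; move: near_ij; clear; lia.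
- apply/forall_inP=> j /free_strip; rewrite -stripE => /andP[_ /=].
  by [].
- apply/forall_inP=> j Fj; apply/forall_inP=> k Fk; apply/implyP=> lt_jk.
  exact: (tab_row tabT lt_jk (strip_cell (free_strip Fj)) (strip_cell (free_strip Fk))).
Qed.

(** A free square has no neighbour in its column that could conflict with its two
    possible labels, and the forced squares of its row lie on the correct
    sides.  A fibre is therefore a product over the rows. *)
Lemma two_valued_fibre T : (forall i, two_valued q (F i) (T0 i) (T i)) ->
  tableau w T && (erase T == erase T0).
Proof.
move=> two.
have off i j : j \notin F i -> T i j = T0 i j.
  by move=> nF; have /and3P[/forallP/(_ j)] := two i; rewrite nF => /eqP.
have on i j : j \in F i -> (q <= T i j <= q.+1)%N.
  move=> Fj; have /and3P[_ /forall_inP/(_ j Fj) + _] := two i.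
  by clear; lia.
have on0 i j : j \in F i -> (q <= T0 i j <= q.+1)%N.
  by move=> Fj; rewrite (strip_ge (free_strip Fj)) (strip_le (free_strip Fj)).
have decr i j k : j \in F i -> k \in F i -> (j < k)%N -> (T i k <= T i j)%N.
  move=> Fj Fk; have /and3P[_ _ /forall_inP/(_ j Fj)/forall_inP/(_ k Fk)/implyP] := two i.
  exact.
have nlow i j : j \in F i -> ~~ lower0 i j by rewrite in_free => /and3P[].
have nupp i j : j \in F i -> ~~ upper0 i j by rewrite in_free => /and3P[].
apply/andP; split; last first.
  apply/eraseP=> i j; have [Fj|nFj] := boolP (j \in F i).
    by right; rewrite on ?on0.
  by left; apply: off.
apply/tableauP; split.
- move=> i j Dij; have [Fj|nFj] := boolP (j \in F i).
    by case/andP: (on i j Fj) => /(leq_trans _) ->.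
  by rewrite off //; apply: (tab_pos tab0).
- move=> i j Dij; have [Fj|nFj] := boolP (j \in F i).
    case/andP: (on i j Fj) => _ /leq_trans; apply.
    by rewrite ltnS (free_row_gt r1E desc asc_r tab0 Fj).
  by rewrite off //; apply: (tab_flag tab0).
- move=> i j nDij; have [/free_strip/strip_cell Dij|nFj] := boolP (j \in F i).
    by rewrite Dij in nDij.
  by rewrite off //; apply: (tab_out tab0).
- move=> i j k lt_jk Dj Dk; have /= row0 := tab_row tab0 lt_jk Dj Dk.
  have [Fj|nFj] := boolP (j \in F i); have [Fk|nFk] := boolP (k \in F i).
  + exact: decr.
  + rewrite (off i k nFk); have onj := on i j Fj; have onj0 := on0 i j Fj.
    have [lt_q|ge_q] := ltnP (T0 i k) q; first by move: lt_q onj; clear; lia.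
    have Sk : strip0 i k.
      by apply: stripP => //=; move: row0 onj0; clear; lia.
    have [L|U] := notin_free nFk Sk.
      have := lower_left tab0 L (free_strip Fj) lt_jk.
      by rewrite (negPf (nlow i j Fj)).
    by have /= -> := upper_val tab0 U; case/andP: onj.
  + rewrite (off i j nFj); have onk := on i k Fk; have onk0 := on0 i k Fk.
    have [gt_q|le_q] := ltnP q (T0 i j); first by move: gt_q onk; clear; lia.
    have Sj : strip0 i j.
      by apply: stripP => //=; move: row0 onk0 le_q; clear; lia.
    have [L|U] := notin_free nFj Sj.
      by have /= E := lower_val tab0 L; move: le_q; rewrite E ltnn.
    have := upper_right r1E desc asc_r av tab0 U (free_strip Fk) lt_jk.
    by rewrite (negPf (nupp i k Fk)).
  + by rewrite !off.
- move=> j g h lt_gh Dg Dh; have /= col0 := tab_col tab0 lt_gh Dg Dh.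
  have upg : strip0 g j -> strip0 h j -> upper0 g j.
    by move=> Sg Sh; rewrite /upper Sg; apply/existsP; exists h; rewrite lt_gh.
  have loh : strip0 g j -> strip0 h j -> lower0 h j.
    by move=> Sg Sh; rewrite /lower Sh; apply/existsP; exists g; rewrite lt_gh.
  have [Fg|nFg] := boolP (j \in F g); have [Fh|nFh] := boolP (j \in F h).
  + have := upg (free_strip Fg) (free_strip Fh).
    by rewrite (negPf (nupp g j Fg)).
  + rewrite (off h j nFh); have ong := on g j Fg; have ong0 := on0 g j Fg.
    have [lt_q|ge_q] := ltnP q.+1 (T0 h j); first by move: lt_q ong; clear; lia.
    have Sh : strip0 h j.
      by apply: stripP => //=; move: col0 ong0; clear; lia.
    by have := upg (free_strip Fg) Sh; rewrite (negPf (nupp g j Fg)).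
  + rewrite (off g j nFg); have onh := on h j Fh; have onh0 := on0 h j Fh.
    have [lt_q|ge_q] := ltnP (T0 g j) q; first by move: lt_q onh; clear; lia.
    have Sg : strip0 g j.
      by apply: stripP => //=; move: col0 onh0; clear; lia.
    by have := loh Sg (free_strip Fh); rewrite (negPf (nlow h j Fh)).
  + by rewrite !off.
Qed.

Lemma fibreE T : tableau w T && (erase T == erase T0) =
  [forall i, two_valued q (F i) (T0 i) (T i)].
Proof.
apply/idP/forallP=> [/andP[tabT eqT]|]; first exact: fibre_two_valued.
exact: two_valued_fibre.
Qed.

End WithTableau.
End Fibre.

(** * Effect of exchanging two variables on the sum over tableaux *)

Section Weights.
Variables (n N : nat) (w : 'S_n) (K : comNzRingType) (x y : nat -> K).

Definition weight (i j : 'I_n) (t : nat) : K := x t - y (content w i j - t)%N.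

Definition row_weight i (rho : {ffun 'I_n -> 'I_N.+1}) : K :=
  \prod_(j | cell w i j) weight i j (rho j).

Definition tab_sum (P : pred {ffun 'I_n -> {ffun 'I_n -> 'I_N.+1}}) : K :=
  \sum_(T | tableau w T && P T) \prod_i row_weight i (T i).

End Weights.

Section FibreSum.
Variables (n N : nat) (w : 'S_n) (r r1 : 'I_n).
Implicit Types i j : 'I_n.
Implicit Types (T : {ffun 'I_n -> {ffun 'I_n -> 'I_N.+1}}).
Hypotheses (r1E : r1 = r.+1 :> nat)
           (desc : forall i j : 'I_n, (i < j)%N -> (j <= r)%N -> (w j < w i)%N)
           (asc_r : (w r < w r1)%N) (av : avoids1432 w).
Hypothesis N_big : forall i, (i < N)%N.
Local Notation q := r.+1.
Local Notation ent T := (fun i j => nat_of_ord (T i j)).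

Variables (K : idomainType) (x y : nat -> K) (s : {rmorphism K -> K}).
Hypotheses (neq_x : x q != x q.+1)
           (s_q : s (x q) = x q.+1) (s_q1 : s (x q.+1) = x q)
           (s_x : forall t, t != q -> t != q.+1 -> s (x t) = x t)
           (s_y : forall t, s (y t) = y t).
Local Notation wt := (weight w x y).

(** The condition on row [r1] that characterises the tableaux of [w] coming from
    those of the swapped permutation. *)
Definition low_corner T : bool :=
  [forall j : 'I_n, (w r < j)%N ==> (T r1 j <= q)%N].

Section WithTableau.
Variable T0 : {ffun 'I_n -> {ffun 'I_n -> 'I_N.+1}}.
Hypothesis tab0 : tableau_spec w (ent T0).
Local Notation F := (free_cols w r (ent T0)).
Local Notation strip0 := (strip w r (ent T0)).
Local Notation lower0 := (lower w r (ent T0)).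
Local Notation upper0 := (upper w r (ent T0)).

Definition fixed_part i : K := \prod_(j | cell w i j && (j \notin F i)) wt i j (T0 i j).

Definition free_part i : K :=
  \sum_(k < #|F i|.+1) \prod_(j in F i)
     wt i j (if (rank (F i) j < k)%N then q.+1 else q).

Lemma row_weight_split i (rho : {ffun 'I_n -> 'I_N.+1}) :
    two_valued q (F i) (T0 i) rho ->
  row_weight w x y i rho = fixed_part i * \prod_(j in F i) wt i j (rho j).
Proof.
case/and3P=> /forallP off _ _; rewrite /row_weight (bigID (mem (F i))) /= mulrC.
congr (_ * _).
  by apply: eq_bigr => j /andP[_ nF]; have := off j; rewrite nF => /eqP ->.
apply: eq_bigl => j; rewrite andb_idl // => Fj.
exact: strip_cell (free_strip Fj).
Qed.

Lemma fibre_row_sum i :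
  \sum_(rho | two_valued q (F i) (T0 i) rho) row_weight w x y i rho
  = fixed_part i * free_part i.
Proof.
rewrite /free_part -(sum_two_valued (ltqN r1E N_big) (F i) (T0 i) (wt i)).
rewrite mulr_sumr; apply: eq_bigr => rho; exact: row_weight_split.
Qed.

Lemma fibre_sum :
  tab_sum w x y (fun T => erase r T == erase r T0)
  = \prod_i fixed_part i * \prod_i free_part i.
Proof.
rewrite -big_split /=.
under [RHS]eq_bigr => i _ do rewrite -fibre_row_sum.
rewrite bigA_distr_big_dep /tab_sum; apply: eq_bigl => T.
rewrite (fibreE r1E desc asc_r av N_big tab0).
by apply/forallP/familyP.
Qed.

(** By the consecutive contents, this is the sum evaluated in [telescope]. *)
Lemma free_part_interval i c :
    (forall j, j \in F i -> content w i j = (c + rank (F i) j + 1)%N) ->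
  (x q - x q.+1) * free_part i
  = \prod_(l < #|F i|.+1) (x q - y (c + l - q)%N)
    - \prod_(l < #|F i|.+1) (x q.+1 - y (c + l - q)%N).
Proof.
move=> cE; rewrite -(telescope _ _ (fun l => y (c + l - q)%N)).
congr (_ * _); apply: eq_bigr => k _.
rewrite -(big_rank _ (F i) (fun l => if (l < k)%N then x q.+1 - y (c + l - q)%N
                                     else x q - y (c + l.+1 - q)%N)) /=.
apply: eq_bigr => j Fj; rewrite /weight cE //.
by case: ifP => _; congr (_ - y _); lia.
Qed.

(** Multiplied by the antisymmetric [x q - x q.+1], the sum becomes
    antisymmetric. *)
Lemma free_part_sym i : s (free_part i) = free_part i.
Proof.
have [c cE] := free_content r1E desc asc_r av tab0 i.
have E := free_part_interval cE.
pose A (b : K) := \prod_(l < #|F i|.+1) (b - y (c + l - q)%N).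
have s_A b : s (A b) = A (s b).
  by rewrite rmorph_prod; apply: eq_bigr => l _; rewrite rmorphB s_y.
have := congr1 s E; rewrite rmorphM !rmorphB s_q s_q1.
rewrite -/(A (x q)) -/(A (x q.+1)) !s_A s_q s_q1 -[RHS]opprB -[in RHS]E.
by rewrite -mulNr opprB => /mulfI; apply; rewrite subr_eq0 eq_sym.
Qed.

(** Each column with a lower square has exactly one upper square, right above it
    among the squares of the diagram, so that the contents differ by one. *)
Lemma prod_upper_lower (G : nat -> K) :
  \prod_i \prod_(j | lower0 i j) G (content w i j - q.+1)%N
  = \prod_i \prod_(j | upper0 i j) G (content w i j - q)%N.
Proof.
rewrite (exchange_big_dep xpredT) //= [RHS](exchange_big_dep xpredT) //=.
apply: eq_bigr => j _.
have lower_uniq g h : lower0 g j -> lower0 h j -> g = h.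
  move=> Lg Lh; have /andP[/strip_cell Cg _] := Lg; have /andP[/strip_cell Ch _] := Lh.
  by apply: (tab_col_inj tab0 Cg Ch); rewrite (lower_val tab0 Lg) (lower_val tab0 Lh).
have upper_uniq g h : upper0 g j -> upper0 h j -> g = h.
  move=> Ug Uh; have /andP[/strip_cell Cg _] := Ug; have /andP[/strip_cell Ch _] := Uh.
  by apply: (tab_col_inj tab0 Cg Ch); rewrite (upper_val tab0 Ug) (upper_val tab0 Uh).
have [/existsP[h Lh]|/existsPn noL] := boolP [exists h : 'I_n, lower0 h j].
  have /andP[Sh /existsP[g0 /andP[lt_gh Sg]]] := Lh.
  have Ug : upper0 g0 j by rewrite /upper Sg; apply/existsP; exists h; rewrite lt_gh.
  rewrite (big_pred1 h) => [|i]; last first.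
    by apply/idP/eqP=> [/lower_uniq/(_ Lh)//|->].
  rewrite (big_pred1 g0) => [|i]; last first.
    by apply/idP/eqP=> [/upper_uniq/(_ Ug)//|->].
  rewrite (@content_below _ w g0 h j) ?subSS ?(strip_cell Sg) ?(strip_cell Sh) //.
  move=> e lt_ge lt_eh; apply/negP=> Ce.
  have /= lt1 := tab_col tab0 lt_ge (strip_cell Sg) Ce.
  have /= lt2 := tab_col tab0 lt_eh Ce (strip_cell Sh).
  move: lt1 lt2; have /= -> := upper_val tab0 Ug; have /= -> := lower_val tab0 Lh.
  by clear; lia.
rewrite !big_pred0 // => i; apply/negbTE => //.
apply/negP=> /andP[Si /existsP[h /andP[lt_ih Sh]]].
by case/negP: (noL h); rewrite /lower Sh; apply/existsP; exists i; rewrite lt_ih.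
Qed.

(** Off the strip, neither of the two variables occurs.  On the forced squares,
    the factors of a lower and an upper square of the same column are exchanged,
    by [prod_upper_lower]. *)
Lemma fixed_part_sym : s (\prod_i fixed_part i) = \prod_i fixed_part i.
Proof.
(* The factors of the lower and the upper squares, with the variable as a
   parameter because [s] changes it. *)
pose outer i := \prod_(j | cell w i j && ~~ strip0 i j) wt i j (T0 i j).
pose low (a : K) := \prod_i \prod_(j | lower0 i j) (a - y (content w i j - q.+1)%N).
pose upp (a : K) := \prod_i \prod_(j | upper0 i j) (a - y (content w i j - q)%N).
have -> : \prod_i fixed_part i = \prod_i outer i * (low (x q.+1) * upp (x q)).
  rewrite /low /upp -!big_split /=; apply: eq_bigr => i _.
  rewrite /fixed_part (bigID (strip0 i)) /= mulrC; congr (_ * _).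
    apply: eq_bigl => j; rewrite -andbA; case: (cell w i j) => //=.
    rewrite in_free negb_and; case: (strip0 i j); rewrite ?andbF //=.
  rewrite (bigID (lower0 i)) /=; congr (_ * _).
    apply: eq_big => [j|j /andP[_ L]].
      rewrite in_free; have [L|] := boolP (lower0 i j); rewrite ?andbF //= andbT.
      by have /andP[S _] := L; rewrite S (strip_cell S).
    by rewrite /weight; have /= -> := lower_val tab0 L.
  apply: eq_big => [j|j /andP[/andP[/andP[_ nF] S] nL]].
    have [U|nU] := boolP (upper0 i j); last first.
      by rewrite in_free nU andbT; case: (strip0 i j); case: (lower0 i j);
        rewrite ?andbF.
    have /andP[S _] := U; rewrite in_free S U (strip_cell S) andbF /=.
    by apply/negP=> L; have := lower_val tab0 L; rewrite (upper_val tab0 U); lia.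
  by rewrite /weight; have [L|/(upper_val tab0)/= ->//] := notin_free nF S;
    rewrite L in nL.
have s_low a : s (low a) = low (s a).
  rewrite rmorph_prod; apply: eq_bigr => i _; rewrite rmorph_prod.
  by apply: eq_bigr => j _; rewrite rmorphB s_y.
have s_upp a : s (upp a) = upp (s a).
  rewrite rmorph_prod; apply: eq_bigr => i _; rewrite rmorph_prod.
  by apply: eq_bigr => j _; rewrite rmorphB s_y.
have low_upp a : low a = upp a by exact: (prod_upper_lower (fun k => a - y k)).
rewrite !rmorphM s_low s_upp s_q s_q1 !low_upp [upp _ * upp _]mulrC.
congr (_ * _); rewrite rmorph_prod; apply: eq_bigr => i _; rewrite rmorph_prod.
apply: eq_bigr => j /andP[Cij nS]; rewrite rmorphB s_y; congr (_ - _).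
by move: nS; rewrite /strip Cij /= negb_or => /andP[]; apply: s_x.
Qed.

Lemma free_below_contentE j : j \in F r1 ->
  content w r1 j = ((w r).+1 + q + rank (F r1) j + 1)%N.
Proof. exact: (free_below_content r1E desc asc_r av tab0). Qed.

(** Right of column [w r], the label [q+1] is excluded from the free squares of
    row [r1], and nothing else changes. *)
Lemma low_row_unique (rho : {ffun 'I_n -> 'I_N.+1}) :
  two_valued q (F r1) (T0 r1) rho
    && [forall j : 'I_n, (w r < j)%N ==> (rho j <= q)%N]
  = (rho == step_row q (F r1) (T0 r1) 0).
Proof.
have lt_q := ltqN r1E N_big.
apply/andP/eqP=> [[two /forallP low]|->]; last first.
  split; first exact: step_row_two_valued.
  apply/forallP=> j; apply/implyP=> lt_wj.
  have [Fj|nF] := boolP (j \in F r1); first by rewrite step_rowE.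
  rewrite ffunE (negPf nF).
  have [Cj|/(tab_out tab0)/= -> //] := boolP (cell w r1 j).
  have /= := tab_flag tab0 Cj; rewrite r1E leq_eqVlt ltnS => /orP[/eqP T0j|//].
  have Sj : strip0 r1 j by rewrite /strip Cj /= T0j eqxx orbT.
  have [|/(upper_val tab0)/= -> //] := notin_free nF Sj.
  move/(lower_corner_lt r1E desc tab0) => lt_jw.
  by move: lt_jw; rewrite ltnNge ltnW.
rewrite -(two_valued_step lt_q two); congr (step_row _ _ _ _).
apply: eq_card0 => j; rewrite !inE; apply/negbTE/negP=> /andP[Fj /eqP rho_j].
rewrite -in_free in Fj; have := low j.
rewrite (free_below_gt r1E desc asc_r tab0 Fj) rho_j /=.
by rewrite ltnn.
Qed.

Lemma fibre_sum_low :
  tab_sum w x y (fun T => low_corner T && (erase r T == erase r T0))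
  = \prod_i fixed_part i * (\prod_(i | i != r1) free_part i
      * \prod_(l < #|F r1|) (x q - y ((w r).+1 + l.+1)%N)).
Proof.
pose Q i (rho : {ffun 'I_n -> 'I_N.+1}) := two_valued q (F i) (T0 i) rho &&
  ((i == r1) ==> [forall j : 'I_n, (w r < j)%N ==> (rho j <= q)%N]).
transitivity (\prod_i \sum_(rho | Q i rho) row_weight w x y i rho).
  rewrite bigA_distr_big_dep /tab_sum; apply: eq_bigl => T.
  rewrite andbCA (fibreE r1E desc asc_r av N_big tab0).
  apply/andP/familyP=> [[low /forallP two] i|two].
    suff: Q i (T i) by [].
    by rewrite /Q two; apply/implyP=> /eqP ->.
  have {}two i : Q i (T i) by exact: two.
  split; first by have := two r1; rewrite /Q eqxx => /andP[_].
  by apply/forallP=> i; case/andP: (two i).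
rewrite (bigD1 r1) //= [\prod_i fixed_part i](bigD1 r1) //=.
have -> : \prod_(i | i != r1) \sum_(rho | Q i rho) row_weight w x y i rho
   = \prod_(i | i != r1) fixed_part i * \prod_(i | i != r1) free_part i.
  rewrite -big_split /=; apply: eq_bigr => i /negPf ne; rewrite -fibre_row_sum.
  by apply: eq_bigl => rho; rewrite /Q ne andbT.
rewrite (big_pred1 (step_row q (F r1) (T0 r1) 0)) => [|rho]; last first.
  by rewrite /Q eqxx; apply: low_row_unique.
rewrite row_weight_split; last exact: step_row_two_valued (ltqN r1E N_big) _ _ _.
have -> : \prod_(j in F r1) wt r1 j (step_row q (F r1) (T0 r1) 0 j)
        = \prod_(l < #|F r1|) (x q - y ((w r).+1 + l.+1)%N).
  rewrite -(big_rank _ (F r1) (fun l => x q - y ((w r).+1 + l.+1)%N)) /=.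
  apply: eq_bigr => j Fj; rewrite step_rowE ?(ltqN r1E N_big) //= /weight.
  by rewrite free_below_contentE //; congr (_ - y _); lia.
by rewrite mulrACA -!mulrA; congr (_ * (_ * _)); rewrite mulrC.
Qed.

(** The factor [x q - y a] completes the product of the single filling of row
    [r1] in [fibre_sum_low] to the one whose divided difference is the sum over
    all fillings of that row, and everything else is symmetric. *)
Lemma fibre_difference (a := (w r).+1)
    (low_sum := tab_sum w x y
       (fun T => low_corner T && (erase r T == erase r T0))) :
  (x q - x q.+1) * tab_sum w x y (fun T => erase r T == erase r T0)
  = (x q - y a) * low_sum - s ((x q - y a) * low_sum).
Proof.
pose G := \prod_i fixed_part i * \prod_(i | i != r1) free_part i.
pose A (b : K) := \prod_(l < #|F r1|.+1) (b - y (a + l)%N).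
have low_sumE : (x q - y a) * low_sum = G * A (x q).
  rewrite /low_sum fibre_sum_low /A big_ord_recl addn0 mulrCA /G -!mulrA.
  by congr (_ * _); rewrite mulrCA.
have s_G : s G = G.
  rewrite rmorphM fixed_part_sym; congr (_ * _); rewrite rmorph_prod.
  by apply: eq_bigr => i _; apply: free_part_sym.
have s_A : s (A (x q)) = A (x q.+1).
  by rewrite rmorph_prod; apply: eq_bigr => l _; rewrite rmorphB s_q s_y.
rewrite low_sumE rmorphM s_G s_A -mulrBr fibre_sum.
rewrite [\prod_i free_part i](bigD1 r1) //= mulrCA.
rewrite [_ * (free_part _ * _)]mulrA (free_part_interval free_below_contentE).
rewrite /G /A -!mulrA; congr (_ * _); rewrite mulrC; congr (_ * (_ - _));
  by apply: eq_bigr => l _; congr (_ - y _); rewrite /a addnAC addnK.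
Qed.

End WithTableau.

Lemma tab_sum_difference (a := (w r).+1) (low_sum := tab_sum w x y low_corner) :
  (x q - x q.+1) * @tab_sum n N w K x y predT
  = (x q - y a) * low_sum - s ((x q - y a) * low_sum).
Proof.
have part (P : pred {ffun 'I_n -> {ffun 'I_n -> 'I_N.+1}}) :
  tab_sum w x y P = \sum_E tab_sum w x y (fun T => P T && (erase r T == E)).
  rewrite /tab_sum (partition_big (erase r) xpredT) //=.
  by apply: eq_bigr => E _; apply: eq_bigl => T; rewrite andbA.
rewrite /low_sum !part !mulr_sumr rmorph_sum -sumrB; apply: eq_bigr => E _.
have [/existsP[T0 /andP[/tableauP tab0 /eqP <-]]|/existsPn none] :=
    boolP [exists T0, tableau w T0 && (erase r T0 == E)].
  exact: fibre_difference.
have none0 (P : pred {ffun 'I_n -> {ffun 'I_n -> 'I_N.+1}}) :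
  tab_sum w x y (fun T => P T && (erase r T == E)) = 0.
  rewrite /tab_sum big_pred0 // => T; apply/negbTE; apply: contra (none T).
  by case/and3P=> -> _ ->.
by rewrite !none0 !mulr0 rmorph0 subr0.
Qed.

End FibreSum.

(** * Moving a row of the diagram across the first ascent *)

Lemma tableau_spec_ext n (w : 'S_n) (T U : 'I_n -> 'I_n -> nat) :
  (forall i j, T i j = U i j) -> tableau_spec w T -> tableau_spec w U.
Proof.
move=> eqTU [pos flag out row col]; split=> *; rewrite -!eqTU; eauto.
Qed.

Section SwapShape.
Local Open Scope nat_scope.
Variables (n : nat) (w : 'S_n) (r r1 : 'I_n).
Implicit Types e g h i j k : 'I_n.
Local Notation u := (swap_at w r).
Local Notation q := r.+1.
Hypotheses (r1S : ordS r = r1) (r1E : r1 = r.+1 :> nat)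
           (desc : forall i j, i < j -> j <= r -> w j < w i)
           (asc_r : w r < w r1).

Lemma swapE e : u e = w (tperm r r1 e).
Proof. by rewrite swap_atE r1S. Qed.

Lemma swap_r : u r = w r1. Proof. by rewrite swapE tpermL. Qed.
Lemma swap_r1 : u r1 = w r. Proof. by rewrite swapE tpermR. Qed.

Lemma swap_other i : i != r -> i != r1 -> u i = w i.
Proof. by move=> ne ne1; rewrite swapE tpermD // eq_sym. Qed.

Lemma ne_r1r : (r1 == r) = false.
Proof. by rewrite -val_eqE /= r1E gtn_eqF. Qed.

Lemma nat_neq i j : i != j -> i <> j :> nat.
Proof. by move=> ne /val_inj/eqP; apply/negP. Qed.

Lemma swap_inv j : (u^-1)%g j = tperm r r1 ((w^-1)%g j).
Proof. by rewrite /swap_at /simple_transp r1S invMg permM tpermV. Qed.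

Lemma cell_swap_other i j : i != r -> i != r1 -> cell u i j = cell w i j.
Proof.
move=> ne ne1; rewrite /cell swap_other // swap_inv.
have nE := nat_neq ne; have n1E := nat_neq ne1.
by move: r1E nE n1E; case: tpermP => [->|->|//] E nE n1E; congr (_ && _); lia.
Qed.

Lemma cell_swap_lower j : cell u r1 j = (j < w r).
Proof.
rewrite /cell swap_r1; have [lt_j|//] := ltnP j (w r).
have /andP[_ lt_p] := cell_below r1E desc asc_r lt_j.
rewrite swap_inv tpermD //; apply: contraTneq lt_p => <-; rewrite -leqNgt //.
by rewrite r1E.
Qed.

Lemma cell_swap_upper j : cell u r j = (j == w r) || cell w r1 j.
Proof.
rewrite /cell swap_r swap_inv; have [->|ne] /= := eqVneq j (w r).
  by rewrite asc_r permK tpermL r1E ltnSn.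
congr (_ && _); case: tpermP => [eq_p|eq_p|].
- by move: ne; rewrite -eq_p permKV eqxx.
- by rewrite eq_p !ltnn.
move=> _ /eqP ne1; rewrite r1E [in RHS]ltn_neqAle.
suff -> : r.+1 != (w^-1)%g j by [].
by apply: contraNneq ne1 => E; apply/eqP/val_inj; rewrite /= r1E -E.
Qed.

(** Apart from [i = r], the rows up to [i] are stable under the swap. *)
Lemma card_swap i j : i != r ->
  #|[set e : 'I_n | (e <= i) && (j < u e)]| =
  #|[set e : 'I_n | (e <= i) && (j < w e)]|.
Proof.
move=> ne; pose s := tperm r r1.
rewrite -[RHS](card_preimset _ (@perm_inj _ s)); apply: eq_card => e.
rewrite !inE swapE -/s; congr (_ && _).
have nE := nat_neq ne.
by rewrite /s; move: r1E nE; clear; case: tpermP => [->|->|//] E nE; lia.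
Qed.

Lemma content_swap_other i j : i != r -> cell u i j -> cell w i j ->
  content u i j = content w i j.
Proof. by move=> ne Cu Cw; rewrite !contentE // card_swap. Qed.

Lemma content_full (v : 'S_n) i j : cell v i j ->
  (forall e, e <= i -> j < v e) -> content v i j = j.+1 + i.+1.
Proof.
move=> Cij full; rewrite contentE //; congr (_ + _).
rewrite -[RHS](card_ord_lt (ltn_ord i)); apply: eq_card => e; rewrite !inE ltnS.
by apply: andb_idr; apply: full.
Qed.

Lemma swap_full j e : j <= w r -> e <= r -> j < u e.
Proof.
move=> le_j; rewrite leq_eqVlt => /orP[/eqP/val_inj->|lt_e].
  by rewrite swap_r (leq_ltn_trans le_j).
rewrite swap_other ?(leq_ltn_trans le_j) ?desc //.
  by apply: contraTneq lt_e => ->; rewrite ltnn.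
by apply: contraTneq lt_e => ->; rewrite r1E ltnNge leqnSn.
Qed.

Lemma swap_full_lower j e : j < w r -> e <= r1 -> j < u e.
Proof.
move=> lt_j le_e; rewrite swapE; apply: (full_below r1E desc asc_r lt_j).
by move: r1E le_e; clear; case: tpermP => [->|->|//] E le_e; lia.
Qed.

Lemma content_swap_upper j : w r < j -> cell w r1 j -> content u r j = content w r1 j.
Proof.
move=> lt_j Cj; rewrite !contentE ?cell_swap_upper ?Cj ?orbT //; congr (_ + _).
pose s := tperm r r1.
rewrite -[RHS](card_preimset _ (@perm_inj _ s)); apply: eq_card => e.
rewrite !inE swapE -/s; have [lt_je|] := boolP (j < w (s e)); rewrite ?andbF //.
rewrite !andbT; move: r1E lt_j lt_je; rewrite /s.
case: tpermP => [->|->|_ ne1] E lt_j; first by rewrite !leqnn.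
  by move=> lt_je; have := ltn_trans lt_j lt_je; rewrite ltnn.
move=> _; have nE : (e : nat) <> r1 by move/val_inj.
by move: E nE; clear; lia.
Qed.

Lemma content_corner_row j : j < w r -> content w r j = j.+1 + q.
Proof.
move=> lt_j; apply: content_full; first by rewrite (cell_initial desc).
move=> e; exact: (full_initial desc).
Qed.

Lemma content_swap_row j : j <= w r -> content u r j = j.+1 + q.
Proof.
move=> le_j; apply: content_full; last by move=> e; apply: swap_full.
rewrite cell_swap_upper; move: le_j; rewrite leq_eqVlt.
by case/orP=> [/eqP/val_inj->|/(cell_below r1E desc asc_r)->]; rewrite ?eqxx ?orbT.
Qed.

Section Raise.
Variable T : 'I_n -> 'I_n -> nat.

(** The squares of row [r1] right of column [w r] move up to row [r], and row [r]
    gains the square of column [w r].  The squares left of it, in both rows,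
    are present before and after, with forced entries. *)
Definition raise i j :=
  if i == r then if j <= w r then q else T r1 j
  else if i == r1 then if j < w r then q.+1 else 0
  else T i j.

Definition sink i j :=
  if i == r then if j < w r then q else 0
  else if i == r1 then
    if j < w r then q.+1 else if j == w r then 0 else T r j
  else T i j.

Lemma raise_r j : raise r j = if j <= w r then q else T r1 j.
Proof. by rewrite /raise eqxx. Qed.
Lemma raise_r1 j : raise r1 j = if j < w r then q.+1 else 0.
Proof. by rewrite /raise ne_r1r eqxx. Qed.
Lemma raise_other i j : i != r -> i != r1 -> raise i j = T i j.
Proof. by move=> /negPf nr /negPf nr1; rewrite /raise nr nr1. Qed.
Lemma sink_r j : sink r j = if j < w r then q else 0.
Proof. by rewrite /sink eqxx. Qed.
Lemma sink_r1 j :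
  sink r1 j = if j < w r then q.+1 else if j == w r then 0 else T r j.
Proof. by rewrite /sink ne_r1r eqxx. Qed.
Lemma sink_other i j : i != r -> i != r1 -> sink i j = T i j.
Proof. by move=> /negPf nr /negPf nr1; rewrite /sink nr nr1. Qed.

End Raise.

Lemma cell_left j : j < w r -> [/\ cell w r j, cell w r1 j, cell u r j & cell u r1 j].
Proof.
move=> lt_j; have C1 := cell_below r1E desc asc_r lt_j.
split=> //; first by rewrite (cell_initial desc).
  by rewrite cell_swap_upper C1 orbT.
by rewrite cell_swap_lower.
Qed.

Lemma other_lt g : g != r -> g < r1 -> g < r.
Proof. by move=> /nat_neq ne; rewrite r1E ltnS leq_eqVlt => /orP[/eqP|]. Qed.

Lemma below_gt h : h != r1 -> r < h -> r1 < h.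
Proof.
by move=> /nat_neq ne lt_h; rewrite ltn_neqAle r1E lt_h andbT -r1E; apply/eqP/nesym.
Qed.

Lemma cell_right j : w r < j -> cell u r j = cell w r1 j.
Proof. by move=> lt_j; rewrite cell_swap_upper -val_eqE gtn_eqF. Qed.

Lemma tab_left T j : tableau_spec w T -> j < w r -> T r j = q /\ T r1 j = q.+1.
Proof.
move=> tabT lt_j; split; first exact: (tab_corner_row desc tabT).
exact: (tab_corner_left r1E desc asc_r tabT).
Qed.

Lemma tab_swap_row T j : tableau_spec u T -> j <= w r -> T r j = q.
Proof.
move=> tabT le_j; apply: (tab_full tabT) => [|e]; last exact: swap_full.
rewrite cell_swap_upper; move: le_j; rewrite leq_eqVlt.
by case/orP=> [/eqP/val_inj->|/(cell_below r1E desc asc_r)->]; rewrite ?eqxx ?orbT.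
Qed.

Lemma tab_swap_below T j : tableau_spec u T -> j < w r -> T r1 j = q.+1.
Proof.
move=> tabT lt_j; rewrite -r1E; apply: (tab_full tabT) => [|e].
  by rewrite cell_swap_lower.
exact: swap_full_lower.
Qed.

Lemma raise_tableau T : tableau_spec w T -> (forall j, w r < j -> T r1 j <= q) ->
  tableau_spec u (raise T).
Proof.
move=> tabT low; split.
- move=> i j; have [->|nr] := eqVneq i r.
    rewrite raise_r; case: (leqP j (w r)) => // lt_j; rewrite cell_right //.
    exact: (tab_pos tabT).
  have [->|nr1] := eqVneq i r1; first by rewrite raise_r1 cell_swap_lower => ->.
  by rewrite raise_other // cell_swap_other //; apply: (tab_pos tabT).
- move=> i j; have [->|nr] := eqVneq i r.
    by rewrite raise_r; case: (leqP j (w r)) => // lt_j _; apply: low.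
  have [->|nr1] := eqVneq i r1.
    by rewrite raise_r1 cell_swap_lower => ->; rewrite r1E.
  by rewrite raise_other // cell_swap_other //; apply: (tab_flag tabT).
- move=> i j; have [->|nr] := eqVneq i r.
    rewrite raise_r; case: (leqP j (w r)) => [|lt_j]; last first.
      by rewrite cell_right //; apply: (tab_out tabT).
    rewrite leq_eqVlt => /orP[/eqP/val_inj->|/cell_left[_ _ -> //]].
    by rewrite cell_swap_upper eqxx.
  have [->|nr1] := eqVneq i r1.
    by rewrite raise_r1 cell_swap_lower => /negPf ->.
  by rewrite raise_other // cell_swap_other //; apply: (tab_out tabT).
- move=> i j k lt_jk; have [->|nr] := eqVneq i r.
    rewrite !raise_r; have [le_k|lt_k] := leqP k (w r).
      by rewrite (leq_trans (ltnW lt_jk)).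
    rewrite (cell_right lt_k); case: (leqP j (w r)) => [_ _ _|lt_j]; first exact: low.
    by rewrite cell_right //; apply: (tab_row tabT).
  have [->|nr1] := eqVneq i r1.
    by rewrite !raise_r1 !cell_swap_lower => -> ->.
  by rewrite !raise_other // !cell_swap_other //; apply: (tab_row tabT).
- move=> j g h lt_gh; have [eq_g|gr] := eqVneq g r.
    rewrite eq_g in lt_gh *; have [->|hr1] := eqVneq h r1.
      rewrite raise_r raise_r1 cell_swap_lower => _ lt_j.
      by rewrite lt_j (ltnW lt_j).
    have hr : h != r by apply: contraTneq lt_gh => ->; rewrite ltnn.
    rewrite raise_r raise_other // [cell u h j]cell_swap_other //.
    have lt_r1h := below_gt hr1 lt_gh.
    case: (leqP j (w r)) => [|lt_j]; last first.
      by rewrite cell_right //; apply: (tab_col tabT).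
    rewrite leq_eqVlt => /orP[/eqP/val_inj-> _|lt_j _ Ch].
      by rewrite /cell permK => /andP[_]; rewrite ltnNge ltnW.
    have [_ C1 _ _] := cell_left lt_j; have [_ <-] := tab_left tabT lt_j.
    exact: ltnW (tab_col tabT lt_r1h C1 Ch).
  have [eq_g|gr1] := eqVneq g r1.
    rewrite eq_g in lt_gh *; rewrite cell_swap_lower raise_r1 => lt_j.
    have hr : h != r by apply: contraTneq lt_gh => ->; rewrite r1E ltnNge leqnSn.
    have hr1 : h != r1 by apply: contraTneq lt_gh => ->; rewrite ltnn.
    rewrite lt_j raise_other // cell_swap_other // => Ch.
    have [_ C1 _ _] := cell_left lt_j; have [_ <-] := tab_left tabT lt_j.
    exact: (tab_col tabT lt_gh C1 Ch).
  rewrite cell_swap_other // raise_other // => Cg.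
  have [eq_h|hr] := eqVneq h r.
    rewrite eq_h in lt_gh *; rewrite raise_r; case: (leqP j (w r)) => [_ _|lt_j].
      exact: leq_ltn_trans (tab_flag tabT Cg) _.
    rewrite cell_right // => Ch; apply: (tab_col tabT) => //.
    by rewrite r1E (ltn_trans lt_gh).
  have [eq_h|hr1] := eqVneq h r1.
    rewrite eq_h in lt_gh *; rewrite cell_swap_lower raise_r1 => ->.
    by apply: leq_ltn_trans (tab_flag tabT Cg) _; rewrite !ltnS ltnW // other_lt.
  by rewrite raise_other // cell_swap_other //; apply: (tab_col tabT).
Qed.

Lemma sink_low T : tableau_spec u T -> forall j, w r < j -> sink T r1 j <= q.
Proof.
move=> tabT j lt_j; rewrite sink_r1 ltnNge (ltnW lt_j) /= -val_eqE gtn_eqF //.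
have [C|nC] := boolP (cell u r j); last by rewrite (tab_out tabT nC).
exact: (tab_flag tabT C).
Qed.

Lemma sink_tableau T : tableau_spec u T -> tableau_spec w (sink T).
Proof.
move=> tabT.
have sink_right j : cell w r1 j -> ~~ (j < w r) -> sink T r1 j = T r j /\ w r < j.
  move=> C; have ne := cell_below_neq r1E C; rewrite -leqNgt leq_eqVlt eq_sym.
  rewrite (negPf ne) /= => lt_j; split=> //.
  by rewrite sink_r1 ltnNge (ltnW lt_j) /= -val_eqE (negPf ne).
split.
- move=> i j; have [->|nr] := eqVneq i r.
    by rewrite sink_r (cell_initial desc) // => ->.
  have [->|nr1] := eqVneq i r1.
    move=> C; have [lt_j|nlt] := boolP (j < w r); first by rewrite sink_r1 lt_j.
    have [-> lt_j] := sink_right _ C nlt; apply: (tab_pos tabT).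
    by rewrite cell_right.
  by rewrite sink_other // -cell_swap_other //; apply: (tab_pos tabT).
- move=> i j; have [->|nr] := eqVneq i r.
    by rewrite sink_r (cell_initial desc) // => ->.
  have [->|nr1] := eqVneq i r1.
    move=> C; have [lt_j|nlt] := boolP (j < w r).
      by rewrite sink_r1 lt_j r1E.
    by have [_ lt_j] := sink_right _ C nlt; rewrite leqW // r1E sink_low.
  by rewrite sink_other // -cell_swap_other //; apply: (tab_flag tabT).
- move=> i j; have [->|nr] := eqVneq i r.
    by rewrite sink_r (cell_initial desc) // => /negPf ->.
  have [->|nr1] := eqVneq i r1.
    rewrite sink_r1; case: ifP => [/cell_left[_ -> //]|nlt]; case: eqP => // ne nC.
    apply: (tab_out tabT); rewrite cell_swap_upper (negPf nC) orbF.
    exact/eqP.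
  by rewrite sink_other // -cell_swap_other //; apply: (tab_out tabT).
- move=> i j k lt_jk; have [->|nr] := eqVneq i r.
    by rewrite !sink_r !(cell_initial desc) // => -> ->.
  have [->|nr1] := eqVneq i r1.
    move=> Cj Ck; have [lt_k|nlt_k] := boolP (k < w r).
      by rewrite !sink_r1 lt_k (ltn_trans lt_jk).
    have [-> lt_k] := sink_right _ Ck nlt_k.
    have [lt_j|nlt_j] := boolP (j < w r).
      rewrite sink_r1 lt_j leqW //; apply: (tab_flag tabT).
      by rewrite cell_right.
    have [-> lt_j] := sink_right _ Cj nlt_j.
    by apply: (tab_row tabT) => //; rewrite cell_right.
  by rewrite !sink_other // -!cell_swap_other //; apply: (tab_row tabT).
- move=> j g h lt_gh; have [eq_g|gr] := eqVneq g r.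
    rewrite eq_g in lt_gh *; rewrite (cell_initial desc) // => lt_j.
    rewrite sink_r lt_j.
    have [->|hr1] := eqVneq h r1; first by rewrite sink_r1 lt_j.
    have hr : h != r by apply: contraTneq lt_gh => ->; rewrite ltnn.
    rewrite sink_other // -cell_swap_other // => Ch.
    have [_ _ _ C1] := cell_left lt_j; rewrite -ltnS -(tab_swap_below tabT lt_j).
    exact: leqW (tab_col tabT (below_gt hr1 lt_gh) C1 Ch).
  have [eq_g|gr1] := eqVneq g r1.
    rewrite eq_g in lt_gh *.
    have hr : h != r by apply: contraTneq lt_gh => ->; rewrite r1E ltnNge leqnSn.
    have hr1 : h != r1 by apply: contraTneq lt_gh => ->; rewrite ltnn.
    rewrite [sink T h j]sink_other // -[cell w h j]cell_swap_other // => Cg Ch.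
    have [lt_j|nlt] := boolP (j < w r).
      rewrite sink_r1 lt_j -(tab_swap_below tabT lt_j).
      by apply: (tab_col tabT) => //; rewrite cell_swap_lower.
    have [-> lt_j] := sink_right _ Cg nlt.
    apply: (tab_col tabT) => //; last by rewrite cell_right.
    by apply: leq_trans lt_gh; rewrite r1E ltnS.
  rewrite -cell_swap_other // sink_other // => Cg.
  have [eq_h|hr] := eqVneq h r.
    rewrite eq_h in lt_gh *; rewrite (cell_initial desc) // sink_r => ->.
    exact: leq_ltn_trans (tab_flag tabT Cg) _.
  have [eq_h|hr1] := eqVneq h r1.
    rewrite eq_h in lt_gh * => Ch; have lt_gr := other_lt gr lt_gh.
    have [lt_j|nlt] := boolP (j < w r).
      rewrite sink_r1 lt_j.
      by apply: leq_ltn_trans (tab_flag tabT Cg) _; rewrite !ltnS ltnW.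
    have [-> lt_j] := sink_right _ Ch nlt.
    by apply: (tab_col tabT) => //; rewrite cell_right.
  by rewrite sink_other // -cell_swap_other //; apply: (tab_col tabT).
Qed.

Lemma raiseK T : tableau_spec w T -> forall i j, sink (raise T) i j = T i j.
Proof.
move=> tabT i j; have [->|nr] := eqVneq i r.
  rewrite sink_r; have [lt_j|le_j] := ltnP; first by have [-> _] := tab_left tabT lt_j.
  by rewrite (tab_out tabT) // (cell_initial desc) // -leqNgt.
have [->|nr1] := eqVneq i r1; last by rewrite sink_other ?raise_other.
rewrite sink_r1 raise_r; have [lt_j|le_j] := ltnP.
  by have [_ ->] := tab_left tabT lt_j.
have [->|ne] := eqVneq j (w r).
  rewrite (tab_out tabT) //; apply/negP=> /(cell_below_neq r1E).
  by rewrite eqxx.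
by rewrite leqNgt ltn_neqAle le_j andbT eq_sym ne.
Qed.

Lemma sinkK T : tableau_spec u T -> forall i j, raise (sink T) i j = T i j.
Proof.
move=> tabT i j; have [->|nr] := eqVneq i r.
  rewrite raise_r; have [le_j|lt_j] := leqP; first by rewrite (tab_swap_row tabT).
  by rewrite sink_r1 ltnNge (ltnW lt_j) /= -val_eqE gtn_eqF.
have [->|nr1] := eqVneq i r1; last by rewrite raise_other ?sink_other.
rewrite raise_r1; have [lt_j|le_j] := ltnP; first by rewrite (tab_swap_below tabT).
by rewrite (tab_out tabT) // cell_swap_lower -leqNgt.
Qed.

End SwapShape.

(** * Sums over tableaux *)

Section SwapSum.
Variables (n N : nat) (w : 'S_n) (r r1 : 'I_n).
Implicit Types i j : 'I_n.
Implicit Types (T : {ffun 'I_n -> {ffun 'I_n -> 'I_N.+1}}).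
Local Notation u := (swap_at w r).
Local Notation q := r.+1.
Local Notation ent T := (fun i j => nat_of_ord (T i j)).
Hypotheses (r1S : ordS r = r1) (r1E : r1 = r.+1 :> nat)
           (desc : forall i j : 'I_n, (i < j)%N -> (j <= r)%N -> (w j < w i)%N)
           (asc_r : (w r < w r1)%N).
Hypothesis N_big : forall i, (i < N)%N.
Variables (K : comNzRingType) (x y : nat -> K).

Definition tab_of (U : 'I_n -> 'I_n -> nat) : {ffun 'I_n -> {ffun 'I_n -> 'I_N.+1}} :=
  [ffun i => [ffun j => inord (U i j)]].

Lemma tab_ofE U i j : (U i j <= N)%N -> tab_of U i j = U i j :> nat.
Proof. by move=> le_N; rewrite !ffunE inordK. Qed.

Lemma tab_le (v : 'S_n) U : tableau_spec v U -> forall i j, (U i j <= N)%N.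
Proof.
move=> tabU i j; have [C|nC] := boolP (cell v i j).
  exact: leq_trans (tab_flag tabU C) (N_big i).
by rewrite (tab_out tabU nC).
Qed.

Lemma tab_of_tableau (v : 'S_n) U : tableau_spec v U -> tableau v (tab_of U).
Proof.
move=> tabU; apply/tableauP; apply: (tableau_spec_ext _ tabU) => i j.
by rewrite tab_ofE // (tab_le tabU).
Qed.

Lemma tab_of_eq T (U : 'I_n -> 'I_n -> nat) : (forall i j, U i j = T i j) -> tab_of U = T.
Proof.
move=> eqUT; apply/ffunP=> i; apply/ffunP=> j; apply: val_inj.
by rewrite /= tab_ofE eqUT // -ltnS.
Qed.

(** A square keeps its content when it moves up, since the swap moves the entry
    of row [r1] to row [r]; the new square is filled by [q] and contributes the
    factor [x q - y (w r).+1]. *)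
Lemma row_weight_raise T : tableau w T -> low_corner w r r1 T ->
  \prod_i row_weight u x y i (tab_of (raise w r r1 (ent T)) i)
  = (x q - y (w r).+1) * \prod_i row_weight w x y i (T i).
Proof.
move=> /tableauP tabT /forallP low.
have {}low j : (w r < j)%N -> (T r1 j <= q)%N by have := low j => /implyP.
have tabU := raise_tableau r1S r1E desc asc_r tabT low.
set U := tab_of _.
have UE i j : U i j = raise w r r1 (ent T) i j :> nat.
  by rewrite tab_ofE // (tab_le tabU).
have ne1 : r1 != r by rewrite (ne_r1r r1E).
pose P1 := \prod_(j : 'I_n | (j < w r)%N) (x q - y j.+1).
pose P2 := \prod_(j : 'I_n | cell w r1 j && (w r < j)%N) weight w x y r1 j (T r1 j).
pose P3 := \prod_(j : 'I_n | (j < w r)%N) weight w x y r1 j q.+1.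
have wr : row_weight w x y r (T r) = P1.
  apply: eq_big => [j|j]; rewrite (cell_initial desc) // => lt_j.
  have [/= -> _] := tab_left r1E desc asc_r tabT lt_j.
  by rewrite /weight (content_corner_row desc) // addnK.
have neC j : cell w r1 j -> j != w r by move/(cell_below_neq r1E); rewrite val_eqE.
have wr1 : row_weight w x y r1 (T r1) = P3 * P2.
  rewrite /row_weight (bigID (fun j : 'I_n => (j < w r)%N)) /=; congr (_ * _).
    apply: eq_big => [j|j /andP[_ lt_j]].
      by apply: andb_idl => /(cell_below r1E desc asc_r).
    by have [_ /= ->] := tab_left r1E desc asc_r tabT lt_j.
  apply: eq_bigl => j; case C: (cell w r1 j) => //=.
  by rewrite -leqNgt [RHS]ltn_neqAle eq_sym (cell_below_neq r1E).
have ur1 : row_weight u x y r1 (U r1) = P3.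
  apply: eq_big => [j|j]; rewrite (cell_swap_lower r1S r1E desc asc_r) // => lt_j.
  rewrite UE (raise_r1 _ r1E) lt_j /weight (content_swap_other r1S r1E) //.
    by rewrite (cell_swap_lower r1S r1E desc asc_r).
  exact: (cell_below r1E desc asc_r).
have ur : row_weight u x y r (U r) = (x q - y (w r).+1) * (P1 * P2).
  rewrite /row_weight (bigD1 (w r)) /=; last first.
    by rewrite (cell_swap_upper r1S r1E asc_r) eqxx.
  congr (_ * _).
    rewrite UE raise_r leqnn /weight.
    by rewrite (content_swap_row r1S r1E desc asc_r) // addnK.
  rewrite (bigID (fun j : 'I_n => (j < w r)%N)) /=; congr (_ * _).
    apply: eq_big => [j|j /andP[_ lt_j]].
      have [lt_j|] := boolP (j < w r)%N; rewrite ?andbF // andbT.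
      rewrite (cell_swap_upper r1S r1E asc_r) (cell_below r1E desc asc_r) //.
      by rewrite orbT -val_eqE ltn_eqF.
    rewrite UE raise_r ltnW // /weight (content_swap_row r1S r1E desc asc_r) ?addnK //.
    exact: ltnW.
  apply: eq_big => [j|j /andP[/andP[Cj ne] ge_j]].
    rewrite (cell_swap_upper r1S r1E asc_r) -leqNgt -andbA.
    rewrite [(w r < j)%N]ltn_neqAle -val_eqE eq_sym.
    by case: eqVneq => //= ?; rewrite ?andbF.
  have lt_j : (w r < j)%N by rewrite ltn_neqAle leqNgt ge_j eq_sym val_eqE ne.
  rewrite UE raise_r leqNgt lt_j /= /weight.
  by rewrite (content_swap_upper r1S r1E asc_r) // -(cell_right r1S r1E asc_r).
rewrite (bigD1 r) //= (bigD1 r1) //= [in RHS](bigD1 r) //= [in RHS](bigD1 r1) //=.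
rewrite ur ur1 wr wr1.
rewrite [X in _ * (_ * X) = _](_ : _ = \prod_(i | (i != r) && (i != r1))
     row_weight w x y i (T i)); last first.
  apply: eq_bigr => i /andP[nr nr1]; apply: eq_big => [j|j Cj].
    exact: (cell_swap_other r1S r1E).
  rewrite UE raise_other // /weight (content_swap_other r1S r1E) //.
  by rewrite -(cell_swap_other r1S r1E).
by rewrite -!mulrA; congr (_ * (_ * _)); rewrite mulrCA.
Qed.

Lemma tab_sum_swap :
  @tab_sum n N u K x y predT
  = (x q - y (w r).+1) * @tab_sum n N w K x y (low_corner w r r1).
Proof.
pose up T := tab_of (raise w r r1 (ent T)).
pose down T := tab_of (sink w r r1 (ent T)).
have downE T : tableau u T -> forall i j, down T i j = sink w r r1 (ent T) i j :> nat.
  move=> /tableauP tabT i j; rewrite tab_ofE //.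
  exact: (tab_le (sink_tableau r1S r1E desc asc_r tabT)).
have down_tab T : tableau u T -> tableau w (down T) && low_corner w r r1 (down T).
  move=> tabT; have tabT' := tableauP _ _ tabT; apply/andP; split.
    exact: tab_of_tableau (sink_tableau r1S r1E desc asc_r tabT').
  apply/forallP=> j; apply/implyP=> lt_j; rewrite downE //.
  exact: (sink_low r1E tabT').
have ext_raise U V : (forall i j, U i j = V i j) ->
    forall i j, raise w r r1 U i j = raise w r r1 V i j.
  by move=> eqUV i j; rewrite /raise !eqUV.
have ext_sink U V : (forall i j, U i j = V i j) ->
    forall i j, sink w r r1 U i j = sink w r r1 V i j.
  by move=> eqUV i j; rewrite /sink !eqUV.
rewrite /tab_sum (reindex_onto up down) => [|T /andP[tabT _]]; last first.
  apply: tab_of_eq => i j; rewrite (ext_raise _ _ (downE T tabT)).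
  exact: (sinkK r1S r1E desc asc_r (tableauP _ _ tabT)).
rewrite mulr_sumr; apply: eq_big => [T|T]; last first.
  case/andP=> /andP[tabU _] /eqP eqT.
  by apply: row_weight_raise; rewrite -eqT; case/andP: (down_tab _ tabU).
rewrite andbT; apply/andP/andP=> [[tabU /eqP eqT]|[tabT /forallP low]].
  by rewrite -eqT; apply/andP/down_tab.
have tabT' := tableauP _ _ tabT.
have {}low j : (w r < j)%N -> (T r1 j <= q)%N by have := low j => /implyP.
have tabU := raise_tableau r1S r1E desc asc_r tabT' low.
split; first exact: tab_of_tableau.
apply/eqP/tab_of_eq => i j.
rewrite (ext_sink _ (raise w r r1 (ent T))) => [|g h].
  exact: (raiseK r1E desc asc_r tabT').
by rewrite tab_ofE // (tab_le tabU).
Qed.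

End SwapSum.

Section Longest.
Variables (n N : nat).
Hypothesis N_big : forall i : 'I_n, (i < N)%N.
Variables (K : comNzRingType) (x y : nat -> K).
Local Notation w0 := (longest n).

Lemma cell_longest (i j : 'I_n) : cell w0 i j = (i + j + 1 < n)%N.
Proof.
have inv : (w0^-1)%g = w0.
  apply/eqP; rewrite eq_invg_mul; apply/eqP/permP=> a; rewrite permM perm1.
  by apply: val_inj; rewrite /= !longestE; have := ltn_ord a; lia.
by rewrite /cell inv !longestE; have := ltn_ord i; have := ltn_ord j; lia.
Qed.

Lemma longest_full (i j e : 'I_n) : cell w0 i j -> (e <= i)%N -> (j < w0 e)%N.
Proof. by rewrite cell_longest longestE; lia. Qed.

(** All columns of this diagram are full, so there is one tableau, with entry
    [i+1] throughout row [i]. *)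
Lemma tab_sum_longest : @tab_sum n N w0 K x y predT
  = \prod_(1 <= i < n.+1) \prod_(1 <= j < n.+1 | (i + j <= n)%N) (x i - y j).
Proof.
pose U (i j : 'I_n) := if cell w0 i j then i.+1 else 0%N.
have tabU : tableau_spec w0 U.
  split; rewrite /U.
  - by move=> i j ->.
  - by move=> i j ->.
  - by move=> i j /negPf->.
  - by move=> i j k _ -> ->.
  - by move=> j g h lt_gh -> ->; rewrite ltnS.
have uniq_tab T : tableau w0 T && true = (T == tab_of N U).
  rewrite andbT; apply/idP/eqP=> [/tableauP tabT|->]; last exact: tab_of_tableau.
  apply/esym/tab_of_eq => i j; rewrite /U; case: ifPn => [C|nC].
    by rewrite [RHS](tab_full tabT C) // => e; apply: longest_full.
  by rewrite [RHS](tab_out tabT nC).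
rewrite /tab_sum (big_pred1 _ uniq_tab) big_add1 big_mkord.
apply: eq_bigr => i _; rewrite big_add1 big_mkord.
apply: eq_big => [j|j C]; first by rewrite cell_longest addn1 addSn addnS.
rewrite tab_ofE ?(tab_le N_big tabU) // /U C /weight content_full //.
  by rewrite addnK.
by move=> e; apply: longest_full.
Qed.

End Longest.

Section SingleValued.
Variables (n : nat) (w : 'S_n) (K : comNzRingType) (G : 'I_n -> 'I_n -> nat -> K).
Local Notation N := (\max_(i < n) flag0 i).

Lemma flag0_max (i : 'I_n) : (i < N)%N.
Proof. exact: (leq_bigmax i). Qed.

(** Squares filled by singletons are replaced by numbers, and tableaux by lists of
    rows, over which products can be distributed. *)
Lemma sum_SRT :
  \sum_(T in SRT w (@flag0 n)) \prod_(c in rothe w) \prod_(t in T c) G c.1 c.2 t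
  = \sum_(T : {ffun 'I_n -> {ffun 'I_n -> 'I_N.+1}} | tableau w T)
      \prod_i \prod_(j | cell w i j) G i j (T i j).
Proof.
pose up (T : {ffun 'I_n -> {ffun 'I_n -> 'I_N.+1}}) : filling (@flag0 n) :=
  [ffun c : 'I_n * 'I_n => if cell w c.1 c.2 then [set T c.1 c.2] else set0].
pose down (S : filling (@flag0 n)) : {ffun 'I_n -> {ffun 'I_n -> 'I_N.+1}} :=
  [ffun i => [ffun j => odflt ord0 [pick t in S (i, j)]]].
have upE T c : up T c = if cell w c.1 c.2 then [set T c.1 c.2] else set0.
  by rewrite ffunE.
have downE T i j : down (up T) i j = if cell w i j then T i j else ord0.
  rewrite 2!ffunE upE /=; case: ifP => _; case: pickP => [t|] //=.
  - by rewrite inE => /eqP.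
  - by move/(_ (T i j)); rewrite inE eqxx.
  - by rewrite inE.
rewrite (reindex_onto up down) => [|S]; last first.
  rewrite inE => /and4P[/forallP shape _ _ _]; apply/ffunP=> -[i j].
  rewrite upE /= !ffunE; have := shape (i, j); rewrite mem_rothe.
  case: ifP => _; last by move/eqP.
  by case/cards1P=> t ->; case: pickP => [t'|/(_ t)]; rewrite ?inE ?eqxx // => /eqP->.
have upP T c t : (t \in up T c) = cell w c.1 c.2 && (t == T c.1 c.2).
  by rewrite upE; case: ifP => _; rewrite inE.
apply: eq_big => [T|T _]; last first.
  rewrite (eq_bigl (fun c => cell w c.1 c.2)) => [|[i j]]; last exact: mem_rothe.
  rewrite (pair_big_dep xpredT (fun i j => cell w i j)) /=.
  by apply: eq_bigr => c C; rewrite upE C big_set1.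
rewrite inE; apply/andP/tableauP=> [[/and4P[_ flag rowT colT] /eqP eqT]|tabT].
  have mem_cell i j : cell w i j -> T i j \in up T (i, j).
    by move=> C; rewrite upP /= C eqxx.
  have {}flag i j : cell w i j -> (0 < T i j <= i.+1)%N.
    by move=> C; have /forallP/(_ (i, j))/forall_inP/(_ _ (mem_cell i j C)) := flag.
  split.
  - by move=> i j /flag/andP[].
  - by move=> i j /flag/andP[].
  - by move=> i j /negPf nC; rewrite -eqT downE nC.
  - move=> i j k lt_jk Cj Ck.
    have /forallP/(_ i)/forallP/(_ j)/forallP/(_ k) := rowT; rewrite lt_jk /=.
    by move/forall_inP/(_ _ (mem_cell i j Cj))/forall_inP/(_ _ (mem_cell i k Ck)).
  - move=> j g h lt_gh Cg Ch.
    have /forallP/(_ j)/forallP/(_ g)/forallP/(_ h) := colT; rewrite lt_gh /=.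
    by move/forall_inP/(_ _ (mem_cell g j Cg))/forall_inP/(_ _ (mem_cell h j Ch)).
split; last first.
  apply/eqP/ffunP=> i; apply/ffunP=> j; rewrite downE; case: ifPn => // nC.
  by apply: val_inj; rewrite /= (tab_out tabT nC).
apply/and4P; split.
- apply/forallP=> -[i j]; rewrite mem_rothe upE /=.
  by case: (cell w i j); rewrite ?cards1 ?eqxx.
- apply/forallP=> -[i j]; apply/forall_inP=> t; rewrite upP => /andP[C /eqP->].
  by rewrite (tab_pos tabT C) (tab_flag tabT C).
- apply/forallP=> i; apply/forallP=> j; apply/forallP=> k; apply/implyP=> lt_jk.
  apply/forall_inP=> t; rewrite upP => /andP[Cj /eqP->].
  apply/forall_inP=> t'; rewrite upP => /andP[Ck /eqP->].
  exact: (tab_row tabT lt_jk Cj Ck).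
- apply/forallP=> j; apply/forallP=> g; apply/forallP=> h; apply/implyP=> lt_gh.
  apply/forall_inP=> t; rewrite upP => /andP[Cg /eqP->].
  apply/forall_inP=> t'; rewrite upP => /andP[Ch /eqP->].
  exact: (tab_col tabT lt_gh Cg Ch).
Qed.
End SingleValued.

(** * The recursion at the first ascent *)

Section FirstAscentExists.
Variables (n : nat) (w : 'S_n).

Lemma first_ascent : w != longest n -> exists2 r : 'I_n, ascent w r &
  forall i j : 'I_n, (i < j)%N -> (j <= r)%N -> (w j < w i)%N.
Proof.
case/not_longest_ascent=> i0 asc0.
case: (@arg_minnP _ i0 (ascent w) (fun i : 'I_n => i : nat) asc0) => r asc_r min_r.
exists r => // i j lt_ij le_jr.
have step (k : 'I_n) : (k < r)%N -> (w (ordS k) < w k)%N.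
  move=> lt_k; have lt_kn : (k.+1 < n)%N by apply: leq_ltn_trans (ltn_ord r).
  have : ~~ ascent w k by apply/negP=> /min_r; rewrite leqNgt lt_k.
  rewrite /ascent lt_kn /= -leqNgt leq_eqVlt => /orP[/eqP/val_inj/perm_inj|//].
  by move/(congr1 val); rewrite /= modn_small // => /eqP; rewrite gtn_eqF.
have [d lt_d] := ubnP (j - i)%N; elim: d i lt_ij lt_d => // d IHd i lt_ij lt_d.
have lt_ir := leq_trans lt_ij le_jr.
have Si := val_ordS (leq_ltn_trans lt_ir (ltn_ord r)).
have [eq_j|ne_j] := eqVneq j (ordS i); first by rewrite eq_j step.
have lt_Sij : (ordS i < j)%N.
  by rewrite ltn_neqAle eq_sym ne_j Si.
apply: ltn_trans (IHd (ordS i) lt_Sij _) (step i lt_ir).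
by rewrite Si; move: lt_ij lt_d; clear; lia.
Qed.

(** A new 1432 pattern would use both swapped positions, in the places of two
    consecutive letters that decrease.  Its letter 1 would then be an entry
    before position [r], and all of these are larger than [w r]. *)
Lemma avoids_swap_first (r : 'I_n) : avoids1432 w -> ascent w r ->
    (forall i j : 'I_n, (i < j)%N -> (j <= r)%N -> (w j < w i)%N) ->
  avoids1432 (swap_at w r).
Proof.
move=> av /andP[lt_rn asc] desc; have SrE := val_ordS lt_rn.
have [r1 r1S] : exists r1, ordS r = r1 by exists (ordS r).
rewrite r1S in SrE asc; rename SrE into r1E.
apply: contra av => /existsP[i1 /existsP[i2 /existsP[i3 /existsP[i4]]]].
rewrite !(swapE w r1S) => /and5P[lt12 lt23 lt34 lt14 /andP[lt43 lt32]].
pose s := tperm r r1.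
have mono (i j : 'I_n) : (i < j)%N -> (i != r) || (j != r1) -> (s i < s j)%N.
  have valN (c d : 'I_n) : c <> d -> c != d :> nat.
    by move=> cd; apply: contra_not_neq cd => /val_inj.
  move=> lt_ij; rewrite /s -!val_eqE; move: lt_ij r1E.
  by case: (tpermP r r1 i) => [->|->|/valN ni /valN ni'];
    case: (tpermP r r1 j) => [->|->|/valN nj /valN nj'] /= lt_ij E;
    rewrite ?eqxx //=; move=> *; lia.
have before (i : 'I_n) : (i < r)%N -> (w r < w (s i))%N.
  move=> lt_i; rewrite tpermD ?desc //; apply: contraTneq lt_i => <-.
    by rewrite ltnn.
  by rewrite r1E ltnNge leqnSn.
apply/existsP; exists (s i1); apply/existsP; exists (s i2).
apply/existsP; exists (s i3); apply/existsP; exists (s i4).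
rewrite lt14 lt43 lt32 !mono //.
- apply: contraTT lt34; rewrite negb_or !negbK => /andP[/eqP eq3 /eqP eq4].
  rewrite eq3 in lt23; have := before i1 (ltn_trans lt12 lt23).
  by move: lt14; rewrite eq4 tpermR => /ltn_trans h /h; rewrite ltnn.
- apply: contraTT lt23; rewrite negb_or !negbK => /andP[/eqP eq2 /eqP eq3].
  rewrite eq2 in lt12; have := before i1 lt12.
  by move: (ltn_trans lt14 lt43); rewrite eq3 tpermR => /ltn_trans h /h; rewrite ltnn.
- apply: contraTT lt12; rewrite negb_or !negbK => /andP[/eqP eq1 /eqP eq2].
  move: (ltn_trans lt14 (ltn_trans lt43 lt32)).
  by rewrite eq1 eq2 tpermL tpermR => /ltn_trans/(_ asc); rewrite ltnn.
Qed.

End FirstAscentExists.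

Lemma mvar_ord n (R : comNzRingType) (i : 'I_n) : mvar n R i.+1 = 'X_i.
Proof. by rewrite /mvar valK. Qed.

Lemma mvarE n (R : comNzRingType) t :
  mvar n R t = 0 \/ exists2 i : 'I_n, t = i.+1 & mvar n R t = 'X_i.
Proof.
case: t => [|t]; first by left.
rewrite /mvar; case: insubP => [i _ eq_i|_]; last by left.
by right; exists i; rewrite // eq_i.
Qed.

(** With [s] exchanging two neighbouring variables, this is the recursion of
    Schubert polynomials at the first ascent. *)
Lemma tab_sum_step (n N : nat) (w : 'S_n) (r : 'I_n) (K : idomainType)
    (x y : nat -> K) (s : {rmorphism K -> K}) :
    ascent w r -> (forall i j : 'I_n, (i < j)%N -> (j <= r)%N -> (w j < w i)%N) ->
    avoids1432 w -> (forall i : 'I_n, (i < N)%N) ->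
    x r.+1 != x r.+2 -> s (x r.+1) = x r.+2 -> s (x r.+2) = x r.+1 ->
    (forall t, t != r.+1 -> t != r.+2 -> s (x t) = x t) ->
    (forall t, s (y t) = y t) ->
  (x r.+1 - x r.+2) * @tab_sum n N w K x y predT
  = @tab_sum n N (swap_at w r) K x y predT
    - s (@tab_sum n N (swap_at w r) K x y predT).
Proof.
case/andP=> lt_rn asc_r desc av N_big neq_x s_q s_q1 s_x s_y.
have SrE := val_ordS lt_rn.
rewrite (tab_sum_swap (erefl (ordS r)) SrE desc asc_r N_big).
exact: tab_sum_difference.
Qed.

Section Step.
Variable n : nat.
Local Notation N := (\max_(i < n) flag0 i).
Local Notation x := (xvar n).
Local Notation y := (yvar n).

Lemma schubert_rec_tab_sum k (w : 'S_n) : avoids1432 w ->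
    (plength w + k = plength (longest n))%N ->
  schubert_rec k w = @tab_sum n N w _ x y predT.
Proof.
elim: k w => [|k IHk] w av len.
  have [->|/not_longest_ascent[i /ascent_lt_longest]] := eqVneq w (longest n).
    exact: esym (tab_sum_longest (@flag0_max n) x y).
  by rewrite -len addn0 ltnn.
have w_neq : w != longest n.
  by apply/eqP=> eq_w; move: len; rewrite eq_w; clear; lia.
have [r asc desc] := first_ascent w_neq.
have IH : schubert_rec k (swap_at w r) = @tab_sum n N (swap_at w r) _ x y predT.
  apply: IHk; first exact: avoids_swap_first.
  by rewrite plength_swap // addSnnS.
rewrite (schubert_rec_ascent len asc) IH.
have /andP[lt_rn asc_r] := asc; have SrE := val_ordS lt_rn.
have neq_r : r != ordS r by rewrite -val_eqE /= modn_small // ltn_eqF.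
have x_r : x r.+1 = 'X_r by exact: mvar_ord.
have x_Sr : x r.+2 = 'X_(ordS r) by rewrite -SrE; exact: mvar_ord.
pose K : idomainType := {mpoly {mpoly int[n]}[n]}.
pose s : {rmorphism K -> K} := msym (tperm r (ordS r)).
have s_q : s (x r.+1) = x r.+2 :> K.
  by rewrite x_r x_Sr; rewrite [LHS]msymXU tpermL.
have s_q1 : s (x r.+2) = x r.+1 :> K.
  by rewrite x_r x_Sr; rewrite [LHS]msymXU tpermR.
have s_x t : t != r.+1 -> t != r.+2 -> s (x t) = x t :> K.
  rewrite /xvar; have [->|[i -> ->]] := mvarE n {mpoly int[n]} t.
    by rewrite rmorph0.
  have r2 : r.+2 = (ordS r).+1 by rewrite SrE.
  rewrite r2 !eqSS => ni ni'; rewrite [LHS]msymXU tpermD //.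
    by rewrite eq_sym.
  by rewrite eq_sym.
have s_y t : s (y t) = y t :> K by exact: mmapC.
have neq_x : (x r.+1 : K) != x r.+2 by rewrite x_r x_Sr; exact: mpolyXU_inj.
have step := tab_sum_step asc desc av (@flag0_max n) neq_x s_q s_q1 s_x s_y.
rewrite x_r x_Sr in step.
exact: divdiff_unique neq_r step.
Qed.

Lemma double_schubertE (w : 'S_n) : avoids1432 w ->
  double_schubert w = \sum_(T in SRT w (@flag0 n)) \prod_(c in rothe w)
    \prod_(t in T c) (x t - y (rothe_rank w c + c.1.+1 - t)%N).
Proof.
move=> av; rewrite /double_schubert schubert_rec_tab_sum //; last first.
  by rewrite subnKC // plength_le_longest.
pose G (i j : 'I_n) t := x t - y (rothe_rank w (i, j) + i.+1 - t)%N.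
transitivity (\sum_(T in SRT w (@flag0 n)) \prod_(c in rothe w)
                 \prod_(t in T c) G c.1 c.2 t).
  by rewrite sum_SRT /tab_sum; apply: eq_bigl => T; rewrite andbT.
by apply: eq_bigr => T _; apply: eq_bigr => -[i j] _.
Qed.

End Step.

Theorem corollary1p3 (n : nat) (w : 'S_n) (w_avoids : avoids1432 w) :
  double_schubert w =
    \sum_(T in SRT w (@flag0 n)) \prod_(c in rothe w) \prod_(t in T c)
      (xvar n t - yvar n (rothe_rank w c + c.1.+1 - t)%N)
  /\
  single_schubert w =
    \sum_(T in SRT w (@flag0 n)) \prod_(c in rothe w) \prod_(t in T c)
      mvar n int t.
Proof.
have map_x m : map_mpoly (meval (fun=> 0)) (xvar n m) = mvar n int m.
  rewrite /xvar /mvar; case: m => [|m]; first by rewrite rmorph0.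
  by case: insubP => [i _ _|_]; rewrite ?map_mpolyX ?rmorph0.
have map_y m : map_mpoly (meval (fun=> 0)) (yvar n m) = 0 :> {mpoly int[n]}.
  rewrite [LHS]map_mpolyC; have [->|[i _ ->]] := mvarE n int m.
    by rewrite [X in X%:MP]meval0 mpolyC0.
  by rewrite [X in X%:MP]mevalXU mpolyC0.
have dbl := double_schubertE w_avoids; split; first exact: dbl.
rewrite /single_schubert dbl rmorph_sum; apply: eq_bigr => T _.
rewrite rmorph_prod; apply: eq_bigr => c _; rewrite rmorph_prod.
apply: eq_bigr => t _; rewrite rmorphB /=.
rewrite map_x map_y subr0; reflexivity.
Qed.
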